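(* Let $\mathbf{k}$ be a field and let $H$ be a Hopf algebra over $\mathbf{k}$ such that the group $G$ of all group-like elements of $H$ is abelian and $H$ is generated as an algebra by $G$ and by skew primitive semi-invariants $a_1,\ldots,a_n$ with fixed positive integer degrees $d_1,\ldots,d_n$. If $H$ has only a finite number of hard super-letters and $G$ is finitely generated, then $H$ is left and right Noetherian.
   Context: Setting. ''Skew primitive semi-invariant'' means: for each $i$ there are $g_i\in G$ and a character $\chi^i:G\to\mathbf{k}^*$ with $\Delta(a_i)=a_i\otimes 1+g_i\otimes a_i$ and $a_i g=\chi^i(g)\,g a_i$ for all $g\in G$. Words. Consider words in the alphabet $a_1,\ldots,a_n$, ordered lexicographically with $a_1>a_2>\cdots>a_n$: two words are compared from left to right at the first distinct letter, and a proper beginning of a word is greater than that word. For a word $u$ let $g_u\in G$ and the character $\chi^u$ be obtained from $u$ by replacing each letter $a_i$ by $g_i$, respectively by $\chi^i$, and put $p_{uv}=\chi^u(g_v)$. A word $u$ with $m_i$ occurrences of $a_i$ has constitution $(m_1,\ldots,m_n)$ and degree $\deg(u)=m_1d_1+\cdots+m_nd_n$. Standard words. A nonempty word $u$ is standard if $u>u_2u_1$ for each factorization $u=u_1u_2$ into nonempty words. A nonassociative (fully bracketed) word $[u]$ is standard if: (1) the word $u$ obtained by erasing brackets is standard; (2) if $[u]=[[v][w]]$ then $[v]$, $[w]$ are standard nonassociative words; (3) if $[u]=[[[v_1][v_2]][w]]$ then $v_2\le w$. By a theorem of Shirshov each standard word has a unique bracketing that is a standard nonassociative word (for $u$ of length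 $\ge 2$ it is $[[v][w]]$ with $u=vw$, $v,w$ standard and $v$ of least possible length). Super-letters and super-words. For a standard word $u$, the super-letter $[u]$ is the polynomial obtained from the standard nonassociative word $[u]$ by interpreting brackets as the skew commutator, defined on polynomials homogeneous in each variable by $[f,h]=fh-p_{uv}hf$, where $u,v$ are any words having the constitutions of $f,h$. It is evaluated as an element of $H$. Super-letters are indexed by standard words and ordered by $[u]>[v]\iff u>v$. A super-word is a (formal) word in super-letters; a $G$-super-word is $gW$ with $g\in G$ and $W$ a super-word (possibly empty). The degree of $gW$ is the sum of the degrees of the super-letters of $W$, with $\deg[u]=\deg(u)$. Hard super-letters. A super-letter $[u]$ is hard if in $H$ it is not a linear combination of super-words of degree $\deg(u)$ in super-letters less than $[u]$ and of $G$-super-words of degree less than $\deg(u)$. *)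

(* Defs.v *)
From HB Require Import structures.
From mathcomp Require Import all_boot all_order all_algebra.
From mathcomp Require Import boolp classical_sets cardinality.

Set Implicit Arguments.
Unset Strict Implicit.
Unset Printing Implicit Defensive.

Import Order.TTheory GRing.Theory.

Local Open Scope quotient_scope.
Local Open Scope ring_scope.

Section Tensor.
Variables (k : fieldType) (V W : lmodType k).

(* The sequence [:: (v1, w1); ...; (vm, wm)] stands for the formal sum of the
   v_i (x) w_i; V (x) W is the free commutative monoid on V * W modulo the
   bilinearity relations (opposites then exist, as scalars act on V). *)
Inductive teq : seq (V * W) -> seq (V * W) -> Prop :=
| teq_refl s : teq s s
| teq_sym s t : teq s t -> teq t s
| teq_trans s t u : teq s t -> teq t u -> teq s u
| teq_cat s s' t t' : teq s s' -> teq t t' -> teq (s ++ t) (s' ++ t')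
| teq_comm s t : teq (s ++ t) (t ++ s)
| teq_addl v v' w : teq [:: (v + v', w)] [:: (v, w); (v', w)]
| teq_addr v w w' : teq [:: (v, w + w')] [:: (v, w); (v, w')]
| teq_scale c v w : teq [:: (c *: v, w)] [:: (v, c *: w)]
| teq_zero w : teq [:: (0, w)] [::].

Definition teqb s t := `[< teq s t >].

Lemma teqb_refl : reflexive teqb.
Proof. by move=> s; apply/asboolP; exact: teq_refl. Qed.

Lemma teqb_sym : symmetric teqb.
Proof. by move=> s t; apply/asboolP/asboolP; exact: teq_sym. Qed.

Lemma teqb_trans : transitive teqb.
Proof. by move=> t s u /asboolP st /asboolP tu; apply/asboolP/(teq_trans st). Qed.

Canonical teqb_equiv := EquivRel teqb teqb_refl teqb_sym teqb_trans.

Definition tensor := {eq_quot teqb}.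

HB.instance Definition _ := Choice.on tensor.

Definition tclass (s : seq (V * W)) : tensor := \pi_({eq_quot teqb}) s.
Definition trepr (x : tensor) : seq (V * W) := repr (x : {eq_quot teqb}).

Lemma treprK x : tclass (trepr x) = x. Proof. exact: reprK. Qed.

Lemma tclassP s t : tclass s = tclass t <-> teq s t.
Proof.
split=> [|st]; first by move/eqmodP => /asboolP.
by apply/eqmodP/asboolP.
Qed.

Lemma teq_repr s : teq (trepr (tclass s)) s.
Proof. by apply/tclassP; rewrite treprK. Qed.

Definition sscale (c : k) (s : seq (V * W)) := [seq (c *: p.1, p.2) | p <- s].

Lemma sscale_cat c s t : sscale c (s ++ t) = sscale c s ++ sscale c t.
Proof. exact: map_cat. Qed.

Lemma teq_sscale c s t : teq s t -> teq (sscale c s) (sscale c t).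
Proof.
elim=> {s t}; do ?by move=> *; rewrite ?sscale_cat; by econstructor; eauto.
- by move=> v v' w; rewrite /= scalerDr; apply: teq_addl.
- by move=> e v w; rewrite /= scalerA mulrC -scalerA; apply: teq_scale.
- by move=> w; rewrite /= scaler0; apply: teq_zero.
Qed.

Definition tzero := tclass [::].
Definition tadd (x y : tensor) := tclass (trepr x ++ trepr y).
Definition tscale c (x : tensor) := tclass (sscale c (trepr x)).
Definition topp := tscale (- 1).

Lemma taddE s t : tadd (tclass s) (tclass t) = tclass (s ++ t).
Proof. by apply/tclassP/teq_cat; apply: teq_repr. Qed.

Lemma tscaleE c s : tscale c (tclass s) = tclass (sscale c s).
Proof. by apply/tclassP/teq_sscale/teq_repr. Qed.

Lemma tensorW (P : tensor -> Prop) : (forall s, P (tclass s)) -> forall x, P x.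
Proof. by move=> Ps x; rewrite -(treprK x). Qed.

Fact taddA : associative tadd.
Proof.
elim/tensorW=> s; elim/tensorW=> t; elim/tensorW=> u.
by rewrite !taddE catA.
Qed.

Fact taddC : commutative tadd.
Proof.
by elim/tensorW=> s; elim/tensorW=> t; rewrite !taddE; apply/tclassP/teq_comm.
Qed.

Fact tadd0 : left_id tzero tadd.
Proof. by elim/tensorW=> s; rewrite taddE. Qed.

Fact taddN : left_inverse tzero topp tadd.
Proof.
elim/tensorW=> s; rewrite /topp tscaleE taddE; apply/tclassP.
elim: s => [|[v w] s IHs]; first exact: teq_refl.
have e0 : teq ([:: (- 1 *: v, w); (v, w)]) [::].
  apply: teq_trans (teq_zero w); rewrite -(addNr v) -scaleN1r.
  exact/teq_sym/teq_addl.
apply: teq_trans (_ : teq _ ([:: (- 1 *: v, w); (v, w)] ++ (sscale (-1) s ++ s))) _.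
  rewrite -[in X in teq X](cat1s (v, w)) catA.
  rewrite -[X in teq _ X]/([:: (-1 *: v, w)] ++ (((v, w) :: sscale (-1) s) ++ s)).
  rewrite -[sscale _ (_ :: _)]/([:: (-1 *: v, w)] ++ sscale (-1) s) -!catA.
  apply: teq_cat (teq_refl _) _; rewrite !catA -cat1s.
  by apply: teq_cat (teq_refl _); rewrite -cat1s; apply: teq_comm.
by rewrite -[X in teq _ X]/([::] ++ [::]); apply: teq_cat.
Qed.

HB.instance Definition _ := GRing.isZmodule.Build tensor taddA taddC tadd0 taddN.

Fact tscaleA a b x : tscale a (tscale b x) = tscale (a * b) x.
Proof.
elim/tensorW: x => s; rewrite !tscaleE; congr tclass.
by rewrite /sscale -map_comp; apply: eq_map => p /=; rewrite scalerA.
Qed.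

Fact tscale1 : left_id 1 tscale.
Proof.
elim/tensorW=> s; rewrite tscaleE; congr tclass.
by rewrite -[RHS]map_id; apply: eq_map => -[v w] /=; rewrite scale1r.
Qed.

Fact tscaleDr : right_distributive tscale +%R.
Proof.
move=> c; elim/tensorW=> s; elim/tensorW=> t.
by rewrite [_ + _]taddE !tscaleE [RHS]taddE sscale_cat.
Qed.

Fact tscaleDl x : {morph tscale^~ x : a b / a + b}.
Proof.
move=> a b; elim/tensorW: x => s; rewrite !tscaleE [RHS]taddE; apply/tclassP.
elim: s => [|[v w] s IHs]; first exact: teq_refl.
apply: teq_trans (_ : teq _ ([:: (a *: v, w); (b *: v, w)]
                              ++ (sscale a s ++ sscale b s))) _.
  rewrite -[sscale _ (_ :: _)]/([:: ((a + b) *: v, w)] ++ sscale (a + b) s).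
  by apply: teq_cat IHs; rewrite scalerDl; apply: teq_addl.
rewrite -[_ ++ _]/([:: (a *: v, w)] ++ (([:: (b *: v, w)] ++ sscale a s)
                                         ++ sscale b s)).
rewrite -[X in teq _ X]/([:: (a *: v, w)] ++ (sscale a s ++ ([:: (b *: v, w)]
                                                   ++ sscale b s))).
apply: teq_cat (teq_refl _) _; rewrite [X in teq _ X]catA.
by apply: teq_cat (teq_refl _); apply: teq_comm.
Qed.

HB.instance Definition _ := GRing.Zmodule_isLmodule.Build k tensor
  tscaleA tscale1 tscaleDr tscaleDl.

Definition pure (v : V) (w : W) : tensor := tclass [:: (v, w)].

Lemma tclass_sum s : tclass s = \sum_(p <- s) pure p.1 p.2.
Proof.
elim: s => [|[v w] s IHs]; first by rewrite big_nil.
by rewrite big_cons -IHs [RHS]taddE.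
Qed.

Lemma tensor_ind (P : tensor -> Prop) :
  P 0 -> (forall x y, P x -> P y -> P (x + y)) -> (forall v w, P (pure v w)) ->
  forall x, P x.
Proof.
by move=> P0 PD Pp x; rewrite -(treprK x) tclass_sum; elim/big_ind: _.
Qed.

Lemma pureDl v v' w : pure (v + v') w = pure v w + pure v' w.
Proof. by rewrite [RHS]taddE; apply/tclassP/teq_addl. Qed.

Lemma pureDr v w w' : pure v (w + w') = pure v w + pure v w'.
Proof. by rewrite [RHS]taddE; apply/tclassP/teq_addr. Qed.

Lemma pureZl c v w : pure (c *: v) w = c *: pure v w.
Proof. by rewrite [RHS]tscaleE. Qed.

Lemma pureZr c v w : pure v (c *: w) = c *: pure v w.
Proof. by rewrite [RHS]tscaleE; apply/tclassP/teq_sym/teq_scale. Qed.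

Lemma pure_bilinear : bilinear_for *:%R *:%R pure.
Proof.
by split=> [w c v v'|v c w w'] /=; rewrite ?(pureDl, pureDr) ?(pureZl, pureZr).
Qed.

(* The linear map induced by a bilinear map f (only used for such f). *)
Definition tlift (U : lmodType k) (f : V -> W -> U) (x : tensor) : U :=
  \sum_(p <- trepr x) f p.1 p.2.

Section Lift.
Variables (U : lmodType k) (f : V -> W -> U).
Hypothesis fbil : bilinear_for *:%R *:%R f.

Let fDl v v' w : f (v + v') w = f v w + f v' w.
Proof. by have := fbil.1 w 1 v v'; rewrite /= !scale1r. Qed.
Let fDr v w w' : f v (w + w') = f v w + f v w'.
Proof. by have := fbil.2 v 1 w w'; rewrite /= !scale1r. Qed.
Let f0l w : f 0 w = 0.
Proof. by apply: (addIr (f 0 w)); rewrite -fDl !add0r. Qed.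
Let f0r v : f v 0 = 0.
Proof. by apply: (addIr (f v 0)); rewrite -fDr !add0r. Qed.
Let fZl c v w : f (c *: v) w = c *: f v w.
Proof. by have := fbil.1 w c v 0; rewrite /= f0l !addr0. Qed.
Let fZr c v w : f v (c *: w) = c *: f v w.
Proof. by have := fbil.2 v c w 0; rewrite /= f0r !addr0. Qed.

Lemma tlift_class s : tlift f (tclass s) = \sum_(p <- s) f p.1 p.2.
Proof.
rewrite /tlift; move: (trepr _) (teq_repr s) => t; elim=> {s t} //=.
- by move=> s t u _ -> _ ->.
- by move=> s s' t t' _ IH1 _ IH2; rewrite !big_cat /= IH1 IH2.
- by move=> *; rewrite !big_cat /= addrC.
- by move=> *; rewrite !big_cons big_nil /= fDl !addr0.
- by move=> *; rewrite !big_cons big_nil /= fDr !addr0.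
- by move=> *; rewrite !big_cons big_nil /= fZl fZr.
- by move=> *; rewrite !big_cons big_nil /= f0l addr0.
Qed.

Lemma tliftE v w : tlift f (pure v w) = f v w.
Proof. by rewrite tlift_class big_seq1. Qed.

Lemma tlift_linear : linear (tlift f).
Proof.
move=> c; elim/tensorW=> s; elim/tensorW=> t.
rewrite [_ *: _]tscaleE [_ + _]taddE !tlift_class big_cat; congr (_ + _).
by rewrite big_map scaler_sumr; apply: eq_bigr => p _ /=.
Qed.

End Lift.

End Tensor.

Notation "v ⊗ w" := (pure v w) (at level 38, left associativity) : ring_scope.

Section TensorMaps.
Variable k : fieldType.

Definition tmap (V V' W W' : lmodType k) (f : V -> V') (g : W -> W')
    : tensor V W -> tensor V' W' :=
  tlift (fun v w => f v ⊗ g w).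

Definition tassoc (U V W : lmodType k)
    : tensor (tensor U V) W -> tensor U (tensor V W) :=
  tlift (fun x w => tlift (fun u v => u ⊗ (v ⊗ w)) x).

End TensorMaps.

Section TensorRing.
Variables (k : fieldType) (A B : algType k).
Local Notation T := (tensor A B).

Definition tone : T := 1 ⊗ 1.
Definition tmul (x y : T) : T :=
  tlift (fun a b => tlift (fun a' b' => (a * a') ⊗ (b * b')) y) x.

Let bil_in a b :
  bilinear_for *:%R *:%R (fun (a' : A) (b' : B) => (a * a') ⊗ (b * b') : T).
Proof.
split=> [v c u u'|u c v v'] /=.
  by rewrite mulrDr pureDl -scalerAr pureZl.
by rewrite mulrDr pureDr -scalerAr pureZr.
Qed.

Let bil_out (y : T) : bilinear_for *:%R *:%R
  (fun (a : A) (b : B) => tlift (fun a' b' => (a * a') ⊗ (b * b')) y : T).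
Proof.
split=> [v c u u'|u c v v'] /=; rewrite /tlift scaler_sumr -big_split;
  apply: eq_bigr => p _ /=.
  by rewrite mulrDl pureDl -scalerAl pureZl.
by rewrite mulrDl pureDr -scalerAl pureZr.
Qed.

Lemma tmulE a b a' b' : tmul (a ⊗ b) (a' ⊗ b') = (a * a') ⊗ (b * b').
Proof. by rewrite /tmul (tliftE (bil_out _)) (tliftE (bil_in _ _)). Qed.

Fact tmulDl : left_distributive tmul +%R.
Proof.
move=> x y z; have := tlift_linear (bil_out z) 1 x y.
by rewrite !scale1r.
Qed.

Fact tmulDr : right_distributive tmul +%R.
Proof.
move=> x y z; rewrite -big_split; apply: eq_bigr => p _ /=.
by have := tlift_linear (bil_in p.1 p.2) 1 y z; rewrite !scale1r.
Qed.

Let tmul0l x : tmul 0 x = 0.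
Proof. by apply: (addIr (tmul 0 x)); rewrite -tmulDl !add0r. Qed.
Let tmul0r x : tmul x 0 = 0.
Proof. by apply: (addIr (tmul x 0)); rewrite -tmulDr !add0r. Qed.

Fact tmulA : associative tmul.
Proof.
elim/tensor_ind=> [y z|x x' IHx IHx' y z|a b]; first by rewrite !tmul0l.
  by rewrite !tmulDl IHx IHx'.
elim/tensor_ind=> [z|y y' IHy IHy' z|a' b']; first by rewrite !(tmul0l, tmul0r).
  by rewrite !(tmulDl, tmulDr) IHy IHy'.
elim/tensor_ind=> [|z z' IHz IHz'|a2 b2]; first by rewrite !tmul0r.
  by rewrite !tmulDr IHz IHz'.
by rewrite !tmulE !mulrA.
Qed.

Fact tmul1l : left_id tone tmul.
Proof.
elim/tensor_ind=> [|x y IHx IHy|a b]; first by rewrite tmul0r.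
  by rewrite tmulDr IHx IHy.
by rewrite tmulE !mul1r.
Qed.

Fact tmul1r : right_id tone tmul.
Proof.
elim/tensor_ind=> [|x y IHx IHy|a b]; first by rewrite tmul0l.
  by rewrite tmulDl IHx IHy.
by rewrite tmulE !mulr1.
Qed.

HB.instance Definition _ := GRing.Zmodule_isPzRing.Build T
  tmulA tmul1l tmul1r tmulDl tmulDr.

Lemma pureM (a a' : A) (b b' : B) : (a ⊗ b) * (a' ⊗ b') = (a * a') ⊗ (b * b') :> T.
Proof. exact: tmulE. Qed.

Lemma pure1 : 1 = 1 ⊗ 1 :> T. Proof. by []. Qed.

End TensorRing.

HB.mixin Record Algebra_isHopf (k : fieldType) H of GRing.Algebra k H := {
  coprod : {lrmorphism H -> tensor H H};
  counit : {lrmorphism H -> k | *%R};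
  antipode : {linear H -> H};
  coprodA : forall x : H,
    tassoc (tmap coprod idfun (coprod x)) = tmap idfun coprod (coprod x);
  counitl : forall x : H, tlift (fun a b => counit a *: b) (coprod x) = x;
  counitr : forall x : H, tlift (fun a b => counit b *: a) (coprod x) = x;
  antipodel : forall x : H,
    tlift (fun a b => antipode a * b) (coprod x) = (counit x)%:A;
  antipoder : forall x : H,
    tlift (fun a b => a * antipode b) (coprod x) = (counit x)%:A
}.

#[short(type="hopfAlgType")]
HB.structure Definition HopfAlgebra (k : fieldType) :=
  {H of Algebra_isHopf k H & GRing.Algebra k H}.

Section GroupLike.
Variables (k : fieldType) (H : hopfAlgType k).
Implicit Types x y : H.

Definition grouplike : pred H :=
  fun x => (coprod x == x ⊗ x) && (counit x == 1).

Lemma antipode_bilinear :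
  bilinear_for *:%R *:%R (fun a b : H => antipode a * b).
Proof.
split=> [b c a a'|a c b b'] /=.
  by rewrite linearP mulrDl scalerAl.
by rewrite mulrDr scalerAr.
Qed.

Lemma bilinear_antipode :
  bilinear_for *:%R *:%R (fun a b : H => a * antipode b).
Proof.
split=> [b c a a'|a c b b'] /=.
  by rewrite mulrDl scalerAl.
by rewrite linearP mulrDr scalerAr.
Qed.

Lemma grouplike1 : grouplike 1.
Proof. by rewrite /grouplike !rmorph1 pure1 !eqxx. Qed.

Lemma grouplikeM x y : grouplike x -> grouplike y -> grouplike (x * y).
Proof.
move=> /andP[/eqP dx /eqP ex] /andP[/eqP dy /eqP ey].
by rewrite /grouplike !rmorphM /= dx dy ex ey pureM mulr1 !eqxx.
Qed.

Lemma grouplikeVl x : grouplike x -> antipode x * x = 1.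
Proof.
move=> /andP[/eqP dx /eqP ex]; have := antipodel x.
by rewrite dx ex scale1r (tliftE antipode_bilinear).
Qed.

Lemma grouplikeVr x : grouplike x -> x * antipode x = 1.
Proof.
move=> /andP[/eqP dx /eqP ex]; have := antipoder x.
by rewrite dx ex scale1r (tliftE bilinear_antipode).
Qed.

Lemma grouplikeV x : grouplike x -> grouplike (antipode x).
Proof.
move=> gx; have [Vl Vr] := (grouplikeVl gx, grouplikeVr gx).
have /andP[/eqP dx /eqP ex] := gx.
apply/andP; split; apply/eqP.
  rewrite -[LHS]mulr1 pure1 -Vr -pureM -dx mulrA -rmorphM Vl rmorph1.
  exact: mul1r.
by rewrite -[LHS]mulr1 -ex -rmorphM Vl rmorph1.
Qed.

Definition grouplikes : Type := {x : H | grouplike x}.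

HB.instance Definition _ := SubChoice.on grouplikes.

Implicit Types g h : grouplikes.

Definition gl_one : grouplikes := Sub 1 grouplike1.
Definition gl_mul g h : grouplikes :=
  Sub (val g * val h) (grouplikeM (valP g) (valP h)).
Definition gl_inv g : grouplikes :=
  Sub (antipode (val g)) (grouplikeV (valP g)).

Fact gl_mulA : associative gl_mul.
Proof. by move=> f g h; apply/val_inj/mulrA. Qed.
Fact gl_mul1g : left_id gl_one gl_mul.
Proof. by move=> g; apply/val_inj/mul1r. Qed.
Fact gl_mulg1 : right_id gl_one gl_mul.
Proof. by move=> g; apply/val_inj/mulr1. Qed.
Fact gl_mulVg : left_inverse gl_one gl_inv gl_mul.
Proof. by move=> g; apply/val_inj/grouplikeVl/valP. Qed.
Fact gl_mulgV : right_inverse gl_one gl_inv gl_mul.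
Proof. by move=> g; apply/val_inj/grouplikeVr/valP. Qed.

HB.instance Definition _ := isGroup.Build grouplikes
  gl_mulA gl_mul1g gl_mulg1 gl_mulVg gl_mulgV.

End GroupLike.

Definition abelian_group (G : groupType) := forall x y : G, commute x y.

Definition fin_generated_group (G : groupType) :=
  exists s : seq G, forall S : {pred G},
    group_closed S -> {subset s <= S} -> forall x, x \in S.

(* A homomorphism from G to the multiplicative group of k *)
Definition is_character (G : groupType) (k : fieldType) (chi : G -> k) :=
  (forall x, chi x != 0) /\ (forall x y, chi (x * y)%g = chi x * chi y).

Definition generates_algebra (k : fieldType) (A : algType k) (E : set A) :=
  forall S : {pred A}, GRing.subalg_closed S -> (forall x, E x -> x \in S) ->
  forall x, x \in S.

Definition lin_comb_of (k : fieldType) (V : lmodType k) (E : set V) (x : V) :=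
  exists (m : nat) (c : 'I_m -> k) (v : 'I_m -> V),
    (forall i, E (v i)) /\ x = \sum_i c i *: v i.

Definition skew_primitive_semi_invariant (k : fieldType) (H : hopfAlgType k)
    (x : H) (g : grouplikes H) (chi : grouplikes H -> k) :=
  [/\ is_character chi, coprod x = x ⊗ 1 + val g ⊗ x
    & forall h : grouplikes H, x * val h = chi h *: (val h * x)].

Section Words.
Variable n : nat.
Implicit Types u v : seq 'I_n.

(* The letter a_i is encoded by the index i; since a_0 > a_1 > ... and a proper
   prefix of a word is greater than the word, this order is the reverse of the
   usual lexicographic order on sequences of indices. *)
Definition wlt u v : bool := ((v : seqlexi 'I_n) < (u : seqlexi 'I_n))%O.
Definition wle u v : bool := ((v : seqlexi 'I_n) <= (u : seqlexi 'I_n))%O.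

Definition standard u : Prop :=
  u != [::] /\
  forall u1 u2, u = u1 ++ u2 -> u1 != [::] -> u2 != [::] -> wlt (u2 ++ u1) u.

Inductive naword := Leaf of 'I_n | Br of naword & naword.

Fixpoint erase (t : naword) : seq 'I_n :=
  match t with
  | Leaf i => [:: i]
  | Br t1 t2 => erase t1 ++ erase t2
  end.

Fixpoint na_standard (t : naword) : Prop :=
  standard (erase t) /\
  match t with
  | Leaf _ => True
  | Br v w =>
      [/\ na_standard v, na_standard w &
        match v with
        | Leaf _ => True
        | Br v1 v2 => wle (erase v2) (erase w)
        end]
  end.

Definition wdeg (d : 'I_n -> nat) u : nat := (\sum_(i <- u) d i)%N.

End Words.

Section SuperLetters.
Variables (k : fieldType) (H : hopfAlgType k) (n : nat).
Variables (a : 'I_n -> H) (d : 'I_n -> nat).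
Variables (g : 'I_n -> grouplikes H) (chi : 'I_n -> grouplikes H -> k).
Implicit Types u v : seq 'I_n.
Implicit Type W : seq (seq 'I_n).

Definition gword u : grouplikes H := (\prod_(i <- u) g i)%g.
Definition chiword u (h : grouplikes H) : k := \prod_(i <- u) chi i h.
Definition pword u v : k := chiword u (gword v).

Fixpoint na_eval (t : naword n) : H :=
  match t with
  | Leaf i => a i
  | Br v w => na_eval v * na_eval w
              - pword (erase v) (erase w) *: (na_eval w * na_eval v)
  end.

(* The value in H of the (unique) standard nonassociative word with underlying
   word u; the default value 0 is only reached when u is not standard. *)
Definition superletter u : H :=
  xget 0 [set x | exists t, [/\ na_standard t, erase t = u & x = na_eval t]].

(* A super-word is encoded by the sequence of the standard words indexing its
   super-letters. *)
Definition superword W : Prop := forall u, u \in W -> standard u.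
Definition sw_deg W : nat := (\sum_(u <- W) wdeg d u)%N.
Definition sw_val W : H := \prod_(u <- W) superletter u.

Definition hard u : Prop :=
  standard u /\
  ~ lin_comb_of
      ([set x | exists W, [/\ superword W, sw_deg W = wdeg d u,
                              forall v, v \in W -> wlt v u & x = sw_val W]]
       `|`
       [set x | exists (h : grouplikes H) W,
                  [/\ superword W, (sw_deg W < wdeg d u)%N
                    & x = val h * sw_val W]])%classic
      (superletter u).

End SuperLetters.

Definition left_ideal (R : pzRingType) (I : set R) :=
  [/\ I 0, forall x y, I x -> I y -> I (x + y) & forall r x, I x -> I (r * x)].

Definition left_noetherian (R : pzRingType) :=
  forall I : set R, left_ideal I ->
  exists (m : nat) (b : 'I_m -> R),
    forall x, I x <-> exists r : 'I_m -> R, x = \sum_i r i * b i.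

Definition right_noetherian (R : pzRingType) := left_noetherian R^c.

(* Main.v *)
Require Import Defs.
From mathcomp Require Import all_boot all_order all_algebra.
From mathcomp Require Import boolp classical_sets cardinality.
From mathcomp Require Import zify.

(* Let [u1] > ... > [uN] be the hard super-letters and y1, ..., yM generators of
   the monoid G. A super-letter that is not hard is replaced by super-words in
   smaller ones, plus terms of smaller degree, so H is spanned by the products
   of the [ui] and the yj. If u > v, then [[u][v]] is a combination of
   super-words in super-letters [w] with w <= uv < u. Order the products by
   degree, then by the number of occurrences of [u1], of [u2], ..., and finally
   of y1, y2, ...: any two generators then commute up to a nonzero scalar modulo
   smaller products. Hence leading terms behave as in a polynomial ring, and
   Dickson's lemma makes every one-sided ideal finitely generated. Only spanning
   is used, so neither the PBW basis theorem nor Hilbert's basis theorem is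
   needed. *)

Set Implicit Arguments.
Unset Strict Implicit.
Unset Printing Implicit Defensive.

Import Order.TTheory GRing.Theory.
Local Open Scope ring_scope.

(** * Algebras spanned by words in quasi-commuting generators *)

Section LinearSpan.
Variables (k : fieldType).

Inductive lspan (V : lmodType k) (E : V -> Prop) : V -> Prop :=
| lspan0 : lspan E 0
| lspan_cons c e x : E e -> lspan E x -> lspan E (c *: e + x).

Variable V : lmodType k.
Implicit Types (E F : V -> Prop) (x y : V).

Lemma lspan_gen E x : E x -> lspan E x.
Proof.
by move=> Ex; rewrite -[x]scale1r -[X in lspan _ X]addr0; apply/lspan_cons/lspan0.
Qed.

Lemma lspanD E x y : lspan E x -> lspan E y -> lspan E (x + y).
Proof.
move=> Ex Ey; elim: Ex => [|c e {}x Ee _ IH]; first by rewrite add0r.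
by rewrite -addrA; apply: lspan_cons.
Qed.

Lemma lspanZ E c x : lspan E x -> lspan E (c *: x).
Proof.
elim=> [|b e {}x Ee _ IH]; first by rewrite scaler0; exact: lspan0.
by rewrite scalerDr scalerA; apply: lspan_cons.
Qed.

Lemma lspanB E x y : lspan E x -> lspan E y -> lspan E (x - y).
Proof. by move=> Ex Ey; rewrite -scaleN1r; apply/lspanD/lspanZ. Qed.

Lemma lspan_subr E x y : lspan E (x - y) -> lspan E y -> lspan E x.
Proof. by move=> Exy Ey; rewrite -(subrK y x); apply: lspanD. Qed.

Lemma lspan_sub E F : (forall x, E x -> lspan F x) ->
  forall x, lspan E x -> lspan F x.
Proof.
move=> EF x; elim=> [|c e {}x Ee _ IH]; first exact: lspan0.
by apply: lspanD => //; apply/lspanZ/EF.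
Qed.

Lemma lspan_lin_comb E x : lin_comb_of E x -> lspan E x.
Proof.
case=> m [c [v [Ev ->]]]; elim/big_ind: _ => [|y y' Ey Ey'|i _].
- exact: lspan0.
- exact: lspanD.
- exact/lspanZ/lspan_gen.
Qed.

End LinearSpan.

Lemma lspanM (k : fieldType) (A : algType k) (E F G : A -> Prop) :
    (forall x y, E x -> F y -> lspan G (x * y)) ->
  forall x y, lspan E x -> lspan F y -> lspan G (x * y).
Proof.
move=> EFG x y Ex; elim: Ex y => [|c e {}x Ee _ IH] y Fy.
  by rewrite mul0r; exact: lspan0.
rewrite mulrDl -scalerAl; apply: lspanD; last exact: IH.
apply: lspanZ; elim: Fy {IH} => [|b f {}y Ff _ IHy].
  by rewrite mulr0; exact: lspan0.
by rewrite mulrDr -scalerAr; apply: lspanD => //; apply/lspanZ/EFG.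
Qed.

Lemma lspanMl (k : fieldType) (A : algType k) (E F : A -> Prop) a :
    (forall x, E x -> lspan F (a * x)) ->
  forall x, lspan E x -> lspan F (a * x).
Proof.
move=> EF x Ex; apply: (lspanM (E := eq a) _ (lspan_gen erefl) Ex).
by move=> _ y <-; apply: EF.
Qed.

Lemma lspanMr (k : fieldType) (A : algType k) (E F : A -> Prop) a :
    (forall x, E x -> lspan F (x * a)) ->
  forall x, lspan E x -> lspan F (x * a).
Proof.
move=> EF x Ex; apply: (lspanM (F := eq a) _ Ex (lspan_gen erefl)).
by move=> y _ Ey <-; apply: EF.
Qed.

(** Dickson's lemma, by induction on the coordinates. If [m] is the largest [t]-coordinate in a
    basis for the remaining coordinates, that basis dominates every element with [t]-coordinate at
    least [m]; each of the finitely many slices below [m] has a basis by induction. *)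
Lemma dickson (X T : Type) (c : T -> X -> nat) (l : seq T) (S : X -> Prop) :
  exists B : seq X, List.Forall S B /\
    forall s, S s -> exists2 b, List.In b B & List.Forall (fun t => (c t b <= c t s)%N) l.
Proof.
elim: l S => [|t l IHl] S.
  have [[s Ss]|noS] := EM (exists s, S s).
    by exists [:: s]; split=> [|s' _]; [constructor | exists s => //; left].
  by exists [::]; split=> // s Ss; case: noS; exists s.
have [B [SB Bbasis]] := IHl S.
have leB b : List.In b B -> (c t b <= \max_(b <- B) c t b)%N.
  elim: B {SB Bbasis} => //= b' B IHB [<-|/IHB le_b]; rewrite big_cons.
    exact: leq_maxl.
  by apply: leq_trans le_b _; exact: leq_maxr.
have small m : exists B' : seq X, List.Forall S B' /\
    forall s, S s -> (c t s < m)%N -> exists2 b, List.In b B' &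
      List.Forall (fun t => (c t b <= c t s)%N) (t :: l).
  elim: m => [|m [B1 [SB1 B1basis]]]; first by exists [::].
  have [B2 [SB2 B2basis]] := IHl (fun s => S s /\ c t s = m).
  exists (B1 ++ B2); split.
    apply/List.Forall_app; split=> //.
    by apply: List.Forall_impl SB2 => s [].
  move=> s Ss; rewrite ltnS leq_eqVlt => /orP[/eqP cs|cs].
    have [b bB2 lb] := B2basis s (conj Ss cs).
    exists b; first by apply/List.in_app_iff; right.
    constructor=> //; move/List.Forall_forall/(_ b bB2): SB2 => [_ ->].
    by rewrite cs.
  have [b bB1 lb] := B1basis s Ss cs.
  by exists b => //; apply/List.in_app_iff; left.
have [B' [SB' B'basis]] := small (\max_(b <- B) c t b)%N.
exists (B ++ B'); split; first exact/List.Forall_app.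
move=> s Ss; have [cs|cs] := ltnP (c t s) (\max_(b <- B) c t b)%N.
  have [b bB' lb] := B'basis s Ss cs.
  by exists b => //; apply/List.in_app_iff; right.
have [b bB lb] := Bbasis s Ss.
exists b; first by apply/List.in_app_iff; left.
by constructor=> //; apply: leq_trans cs; apply: leB.
Qed.

(** * Words as commutative monomials: the order and its well-foundedness *)

Section MonomialOrder.
Variables (T : finType) (rank deg : T -> nat).
Hypothesis rank_inj : injective rank.
Implicit Types U V W : seq T.

Definition mdeg W : nat := (\sum_(t <- W) deg t)%N.

(* Occurrences of letters of small rank are the most significant. This is only a
   preorder: words that are permutations of each other are not separated. *)
Definition mlt V W : Prop :=
  (mdeg V < mdeg W)%N \/
  mdeg V = mdeg W /\
  exists2 t, (count_mem t V < count_mem t W)%N &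
    forall t', (rank t' < rank t)%N -> count_mem t' V = count_mem t' W.

Lemma mdeg_cat V W : mdeg (V ++ W) = (mdeg V + mdeg W)%N.
Proof. exact: big_cat. Qed.

Lemma mlt_catl U V W : mlt V W -> mlt (U ++ V) (U ++ W).
Proof.
case=> [ltVW|[eqVW [t ltt eqt]]]; first by left; rewrite !mdeg_cat ltn_add2l.
right; rewrite !mdeg_cat eqVW; split=> //; exists t.
  by rewrite !count_cat ltn_add2l.
by move=> t' /eqt; rewrite !count_cat => ->.
Qed.

Lemma mlt_catr U V W : mlt V W -> mlt (V ++ U) (W ++ U).
Proof.
case=> [ltVW|[eqVW [t ltt eqt]]]; first by left; rewrite !mdeg_cat ltn_add2r.
right; rewrite !mdeg_cat eqVW; split=> //; exists t.
  by rewrite !count_cat ltn_add2r.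
by move=> t' /eqt; rewrite !count_cat => ->.
Qed.

Lemma mlt_trans U V W : mlt U V -> mlt V W -> mlt U W.
Proof.
case=> [ltUV|[eqUV [s lts eqs]]] [ltVW|[eqVW [t ltt eqt]]].
- by left; apply: ltn_trans ltVW.
- by left; rewrite -eqVW.
- by left; rewrite eqUV.
right; rewrite eqUV; split=> //; have [lst|lts'|est] := ltngtP (rank s) (rank t).
- exists s; first by rewrite -eqt.
  by move=> t' lt'; rewrite eqs // eqt // (ltn_trans lt').
- exists t; first by rewrite eqs.
  by move=> t' lt'; rewrite eqs ?eqt // (ltn_trans lt').
- move/rank_inj: est lts eqs => -> lts eqs.
  exists t; first exact: ltn_trans ltt.
  by move=> t' lt'; rewrite eqs ?eqt.
Qed.

Lemma mlt_irr W : ~ mlt W W.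
Proof. by case=> [|[_ [t]]]; rewrite ltnn. Qed.

Lemma mlt_perml V V' W : perm_eq V V' -> mlt V W -> mlt V' W.
Proof.
move=> VV'; rewrite /mlt /mdeg (perm_big _ VV') /=.
case=> [|[eqVW [t ltt eqt]]]; [by left | right; split=> //].
by exists t => [|t' /eqt]; rewrite -(permP VV').
Qed.

Lemma mlt_permr V W W' : perm_eq W W' -> mlt V W -> mlt V W'.
Proof.
move=> WW'; rewrite /mlt /mdeg (perm_big _ WW') /=.
case=> [|[eqVW [t ltt eqt]]]; [by left | right; split=> //].
by exists t => [|t' /eqt]; rewrite -(permP WW').
Qed.

Lemma mlt_total V W : [\/ mlt V W, mlt W V | perm_eq V W].
Proof.
have [ltVW|ltWV|eqVW] := ltngtP (mdeg V) (mdeg W).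
- by constructor 1; left.
- by constructor 2; left.
have [VW|VW] := boolP (perm_eq V W); first by constructor 3.
have ne : [exists t, count_mem t V != count_mem t W].
  apply/existsP; apply: contrapT => nex; case/negP: VW; apply/permP/permP/allP=> t _.
  by apply/negPn/negP => net; case: nex; exists t.
have [t0 net0] := existsP ne.
have [t net mint] := @arg_minnP _ t0 (fun t => count_mem t V != count_mem t W) rank net0.
have eqt t' : (rank t' < rank t)%N -> count_mem t' V = count_mem t' W.
  by move=> lt'; apply/eqP/negPn/negP => /mint; rewrite leqNgt lt'.
have [lt|lt|eq] := ltngtP (count_mem t V) (count_mem t W).
- by constructor 1; right; split=> //; exists t.
- by constructor 2; right; split=> //; exists t => // t' /eqt.
- by rewrite eq eqxx in net.
Qed.

Lemma sub_count_perm V W : (forall t, count_mem t V <= count_mem t W)%N ->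
  exists U, perm_eq (U ++ V) W.
Proof.
elim: V W => [|t V IH] W sVW; first by exists W; rewrite cats0.
have tW : t \in W by rewrite -has_pred1 has_count; have := sVW t; rewrite /= eqxx; lia.
have [t'|U UV] := IH (rem t W).
  have := sVW t'; have /permP/(_ (pred1 t')) /= -> := perm_to_rem tW; lia.
exists U; rewrite (perm_trans _ (_ : perm_eq (t :: rem t W) W)) //.
  by rewrite perm_catC /= perm_cons perm_catC.
by rewrite perm_sym perm_to_rem.
Qed.

(** Up to permutation a word is a monomial and [U ++ b] a multiple of [b], so this is Dickson's
    lemma for the letter counts. *)
Lemma word_basis (S : seq T -> Prop) : exists B : seq (seq T),
  (forall b, b \in B -> S b) /\
  forall W, S W -> exists U b, b \in B /\ perm_eq (U ++ b) W.
Proof.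
have [B [SB Bbasis]] := dickson (fun t W => count_mem t W) (enum T) S.
have inB b : List.In b B <-> b \in B.
  elim: B {SB Bbasis} => //= b' B IH; rewrite inE; split.
    by case=> [->|/IH ->]; rewrite ?eqxx ?orbT.
  by case/orP=> [/eqP->|/IH]; [left | right].
exists B; split=> [b /inB bB|W /Bbasis[b /inB bB leb]].
  by move/List.Forall_forall: SB; apply.
have [t|U UW] := @sub_count_perm b W; last by exists U, b.
move/List.Forall_forall: leb; apply.
elim: (enum T) (mem_enum T t) => //= t' l IH; rewrite inE.
by case/orP=> [/eqP->|/IH]; [left | right].
Qed.

Lemma mlt_catr_id U W : ~ mlt (U ++ W) W.
Proof.
case=> [|[_ [t]]]; first by rewrite mdeg_cat; lia.
by rewrite count_cat; lia.
Qed.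

(** Letters of degree zero allow infinitely many words of one degree, so a minimum is sought in a
    finite basis of [S] under divisibility. It is minimal in all of [S], because every word of [S]
    is a multiple of a basis word and no multiple precedes the word it is a multiple of. *)
Lemma mlt_minimal (S : seq T -> Prop) W : S W ->
  exists2 V, S V & forall U, S U -> ~ mlt U V.
Proof.
move=> SW; have [B [SB Bbasis]] := word_basis S.
have [V VB minV] : exists2 V, V \in B & forall U, U \in B -> ~ mlt U V.
  have [_ [b [bB _]]] := Bbasis W SW.
  elim: B b bB {SB Bbasis} => // b [|b' B] IH _ _.
    by exists b; rewrite ?inE // => U; rewrite inE => /eqP->; exact: mlt_irr.
  have [V VB minV] := IH b' (mem_head _ _).
  have [ltbV|nltbV] := EM (mlt b V).
    exists b; rewrite ?mem_head // => U; rewrite inE => /orP[/eqP->|UB].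
      exact: mlt_irr.
    by move=> /mlt_trans/(_ ltbV); apply: minV.
  exists V; first by rewrite inE VB orbT.
  by move=> U; rewrite inE => /orP[/eqP->|/minV].
exists V; first exact: SB.
move=> U SU ltUV; have [U' [b [bB UbU]]] := Bbasis U SU.
have [ltbV|ltVb|bV] := mlt_total b V; first exact: minV ltbV.
  have ltUb := mlt_trans ltUV ltVb.
  by apply: (@mlt_catr_id U' b); apply: mlt_perml ltUb; rewrite perm_sym.
apply: (@mlt_catr_id U' b); apply: (@mlt_perml U); first by rewrite perm_sym.
by apply: mlt_permr ltUV; rewrite perm_sym.
Qed.

Lemma mlt_ind (P : seq T -> Prop) :
  (forall W, (forall V, mlt V W -> P V) -> P W) -> forall W, P W.
Proof.
move=> IH W; apply: contrapT => nPW.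
have [V nPV minV] := mlt_minimal (S := fun W => ~ P W) nPW.
by apply: nPV; apply: IH => U ltUV; apply: contrapT => /minV.
Qed.

End MonomialOrder.

(** * Leading words and finite generation of one-sided ideals *)

Definition submod (k : fieldType) (V : lmodType k) (I : V -> Prop) :=
  [/\ I 0, forall x y, I x -> I y -> I (x + y) & forall c x, I x -> I (c *: x)].

Section QuasiCommutative.
Variables (k : fieldType) (A : algType k).
Variables (T : finType) (rank deg : T -> nat) (z : T -> A).
Hypothesis rank_inj : injective rank.
Implicit Types (U V W : seq T) (x y : A).
Local Notation mlt := (mlt rank deg).

Definition word_val W : A := \prod_(t <- W) z t.

(** The lower-order terms relative to [W]. Values of distinct words may be linearly dependent, so
    leading terms are handled as congruences modulo [below W], not as invariants of an element. *)
Definition below W : A -> Prop :=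
  lspan (fun x => exists2 V, mlt V W & x = word_val V).

Hypothesis commutation : forall s t, (rank s < rank t)%N ->
  exists2 q : k, q != 0 & below [:: s; t] (z s * z t - q *: (z t * z s)).
Hypothesis word_span : forall x, lspan (fun y => exists W, y = word_val W) x.

Lemma word_val_cat V W : word_val (V ++ W) = word_val V * word_val W.
Proof. exact: big_cat. Qed.

Lemma word_val_cons t W : word_val (t :: W) = z t * word_val W.
Proof. exact: big_cons. Qed.

Lemma below_perm W W' x : perm_eq W W' -> below W x -> below W' x.
Proof.
move=> WW'; apply: lspan_sub => y [V ltVW ->].
by apply: lspan_gen; exists V => //; apply: mlt_permr ltVW.
Qed.

Lemma belowMl U W x : below W x -> below (U ++ W) (word_val U * x).
Proof.
apply: lspanMl => {}x [V ltVW ->]; apply: lspan_gen.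
by exists (U ++ V); [exact: mlt_catl | rewrite word_val_cat].
Qed.

Lemma belowMr U W x : below W x -> below (W ++ U) (x * word_val U).
Proof.
apply: lspanMr => {}x [V ltVW ->]; apply: lspan_gen.
by exists (V ++ U); [exact: mlt_catr | rewrite word_val_cat].
Qed.

Lemma below_mlt V W x : mlt V W -> below V x -> below W x.
Proof.
move=> ltVW; apply: lspan_sub => y [U ltUV ->].
by apply: lspan_gen; exists U => //; apply: mlt_trans ltVW.
Qed.

Lemma swap_letters s t : exists2 q : k, q != 0 &
  below [:: s; t] (z s * z t - q *: (z t * z s)).
Proof.
have [/commutation//|/commutation[q q0 bq]|/rank_inj <-] := ltngtP (rank s) (rank t).
  exists q^-1; first by rewrite invr_eq0.
  have : below [:: s; t] (z t * z s - q *: (z s * z t)).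
    by apply: below_perm bq; rewrite (perm_catC [:: t] [:: s]).
  move=> /(lspanZ (- q^-1)).
  by rewrite scalerBr scalerA mulNr mulVf // !scaleNr scale1r opprK addrC.
by exists 1; rewrite ?oner_eq0 // scale1r subrr; exact: lspan0.
Qed.

Lemma move_letter t U V : exists2 q : k, q != 0 &
  below (t :: U ++ V) (word_val (t :: U ++ V) - q *: word_val (U ++ t :: V)).
Proof.
elim: U => [|s U [q q0 IH]] /=.
  by exists 1; rewrite ?oner_eq0 // scale1r subrr; exact: lspan0.
have [p p0 bp] := swap_letters t s.
exists (p * q); first by rewrite mulf_neq0.
(* First swap [t] with [s], then move [t] through [U] behind [s]. *)
rewrite -(subrK (p *: (word_val (s :: t :: U ++ V))) (word_val _)) -addrA.
apply: lspanD.
  rewrite !word_val_cons !mulrA scalerAl -mulrBl.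
  exact: (belowMr (U ++ V) bp).
rewrite -scalerA -scalerBr; apply: lspanZ; rewrite (word_val_cons s (U ++ _)).
rewrite scalerAr (word_val_cons s) -mulrBr.
have /(belowMl [:: s]) := IH; rewrite /word_val big_seq1.
by apply: below_perm; rewrite (perm_catCA [:: s] [:: t]).
Qed.

(** The tail of [W] is first brought into the order of [W'] without the head letter, which is then
    moved to its place; each swap costs a nonzero scalar and lower terms. *)
Lemma reorder_word W W' : perm_eq W W' -> exists2 q : k, q != 0 &
  below W (word_val W - q *: word_val W').
Proof.
elim: W W' => [|t W IH] W'.
  rewrite perm_sym => /perm_nilP ->; exists 1; rewrite ?oner_eq0 // scale1r subrr.
  exact: lspan0.
move=> tWW'; have tW' : t \in W' by rewrite -(perm_mem tWW') mem_head.
case/splitPr: tW' tWW' => U V tWUV.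
have WUV : perm_eq W (U ++ V).
  by rewrite -(perm_cons t) (perm_trans tWUV) // perm_catC /= perm_cons perm_catC.
have [q q0 bq] := IH _ WUV; have [p p0 bp] := move_letter t U V.
exists (q * p); first by rewrite mulf_neq0.
rewrite -(subrK (q *: (word_val (t :: U ++ V))) (word_val _)) -addrA.
apply: lspanD.
  rewrite !word_val_cons scalerAr -mulrBr.
  by have /(belowMl [:: t]) := bq; rewrite /word_val big_seq1.
rewrite -scalerA -scalerBr; apply: lspanZ.
by apply: below_perm bp; rewrite perm_cons perm_sym.
Qed.

(** Terms are added one by one, keeping the greater leading word; of two words that are permutations
    of each other, one is rewritten through the other. Coefficients may then cancel, so [c] can be
    zero. *)
Lemma leading_word (S : seq T -> Prop) x :
    lspan (fun y => exists2 V, S V & y = word_val V) x ->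
  x = 0 \/ exists V, S V /\ exists c, below V (x - c *: word_val V).
Proof.
elim=> [|c _ {}x [V SV ->] _ [->|[U [SU [b bx]]]]]; first by left.
  right; exists V; split=> //; exists c.
  by rewrite addr0 subrr; exact: lspan0.
right; have [ltVU|ltUV|VU] := mlt_total rank deg V U.
- exists U; split=> //; exists b; rewrite -addrA; apply: lspanD => //.
  by apply/lspanZ/lspan_gen; exists V.
- exists V; split=> //; exists c; rewrite addrC addKr.
  apply: (lspan_subr (y := b *: word_val U)); first exact: below_mlt bx.
  by apply/lspanZ/lspan_gen; exists U.
have [q q0 bq] := reorder_word VU.
exists U; split=> //; exists (b + c * q).
have -> : c *: word_val V + x - (b + c * q) *: word_val U =
   c *: (word_val V - q *: word_val U) + (x - b *: word_val U).
  by rewrite scalerBr scalerDl scalerA opprD addrA addrACA addrA addrAC.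
by apply: lspanD => //; apply: lspanZ; apply: below_perm bq.
Qed.

(* [op U] is the multiplication by [word_val U], on the left or on the right. *)
Lemma ideal_basis (op : seq T -> A -> A) (I : A -> Prop) :
    (forall U c x y, op U (c *: x + y) = c *: op U x + op U y) ->
    (forall U W x, below W x -> below (U ++ W) (op U x)) ->
    (forall U V, exists2 q : k, q != 0 &
       below (U ++ V) (op U (word_val V) - q *: word_val (U ++ V))) ->
    submod I -> (forall U x, I x -> I (op U x)) ->
  exists2 B : seq A, (forall b, b \in B -> I b) &
    forall J : A -> Prop, submod J -> (forall U x, J x -> J (op U x)) ->
      (forall b, b \in B -> J b) -> forall x, I x -> J x.
Proof.
move=> op_lin op_below op_word [I0 ID IZ] Iop.
pose lead W f := I f /\ below W (f - word_val W).
have [B [SB Bbasis]] := word_basis (fun W => exists f, lead W f).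
(* The default 0 is never met on [B], whose words all lead some monic element of [I]. *)
pose F W := xget 0 [set f | lead W f]%classic.
have FP W : (exists f, lead W f) -> lead W (F W).
  by move=> /(xgetPex 0).
exists [seq F W | W <- B] => [_ /mapP[W WB ->]|J [J0 JD JZ] Jop JB x Ix].
  by have [] := FP W (SB W WB).
have JF W : W \in B -> J (F W) by move=> WB; apply/JB/map_f.
(* Induction on [V] along the order. When [c] is zero, [x] vanishes or has a smaller leading
   word. *)
suff main V : forall x c, I x -> below V (x - c *: word_val V) -> J x.
  have /leading_word[->//|[V [_ [c]]]] :
    lspan (fun y => exists2 V, True & y = word_val V) x.
    by apply: lspan_sub (word_span x) => y [W ->]; apply: lspan_gen; exists W.
  exact: main.
elim/(mlt_ind (deg := deg) rank_inj): V {x Ix} => V IH.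
have J_below x : I x -> below V x -> J x.
  move=> Ix /leading_word[->//|[W [ltWV [c bx]]]].
  exact: IH bx.
move=> x c Ix bx; have [c0|c0] := eqVneq c 0.
  by apply: J_below => //; move: bx; rewrite c0 scale0r subr0.
have [|U [b [bB UbV]]] := Bbasis V.
  exists (c^-1 *: x); split; first exact: IZ.
  by have /(lspanZ c^-1) := bx; rewrite scalerBr scalerA mulVf // scale1r.
have [Ib bb] := FP b (SB b bB).
have [q q0 bq] := op_word U b; have [p p0 bp] := reorder_word UbV.
have bop : below V (op U (F b) - (q * p) *: word_val V).
  apply: below_perm UbV _.
  have opB y y' : op U (y - y') = op U y - op U y'.
    by rewrite -scaleN1r addrC op_lin scaleN1r addrC.
  have -> : op U (F b) - (q * p) *: word_val V = op U (F b - word_val b) +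
      ((op U (word_val b) - q *: word_val (U ++ b)) +
        q *: (word_val (U ++ b) - p *: word_val V)).
    by rewrite opB scalerBr scalerA addrA !subrKA.
  apply: lspanD; first exact: op_below.
  by apply: lspanD => //; apply: lspanZ.
(* The multiple [op U (F b)] has coefficient [q * p] at [V], so subtracting [e] times it from [x]
   cancels the term [c *: word_val V]. *)
set e := c / (q * p).
rewrite -[x](subrK (e *: op U (F b))); apply: JD; last first.
  by apply/JZ/Jop/JF.
apply: J_below; first by apply: ID => //; rewrite -scaleNr; apply/IZ/Iop.
have -> : x - e *: op U (F b) = (x - c *: word_val V) -
    e *: (op U (F b) - (q * p) *: word_val V).
  by rewrite scalerBr scalerA divfK ?mulf_neq0 // opprB addrA subrK.
by apply: lspanB => //; apply: lspanZ.
Qed.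

Lemma quasi_commutative_left_noetherian : left_noetherian A.
Proof.
move=> I [I0 ID IM].
have IZ c x : I x -> I (c *: x) by move=> /(IM c%:A); rewrite mulr_algl.
have [|||||B BI Bgen] := @ideal_basis (fun U => *%R (word_val U)) I.
- by move=> U c x y; rewrite mulrDr scalerAr.
- exact: belowMl.
- move=> U V; exists 1; rewrite ?oner_eq0 // scale1r -word_val_cat subrr.
  exact: lspan0.
- by split.
- by move=> U x; apply: IM.
exists (size B), (fun i => B`_i) => x; split=> [Ix|[r ->]]; last first.
  by elim/big_ind: _ => // i _; apply/IM/BI/mem_nth.
(* Here [J] is the set of left linear combinations of the entries of [B]. *)
move: x Ix; apply: Bgen; first split.
- by exists (fun=> 0); rewrite big1 // => i _; rewrite mul0r.
- move=> _ _ [r ->] [r' ->]; exists (fun i => r i + r' i).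
  by rewrite -big_split; apply: eq_bigr => i _; rewrite mulrDl.
- move=> c _ [r ->]; exists (fun i => c *: r i).
  by rewrite scaler_sumr; apply: eq_bigr => i _; rewrite scalerAl.
- move=> U _ [r ->]; exists (fun i => word_val U * r i).
  by rewrite mulr_sumr; apply: eq_bigr => i _; rewrite mulrA.
move=> b bB; have ib : (index b B < size B)%N by rewrite index_mem.
exists (fun i => (i == Ordinal ib)%:R); rewrite (bigD1 (Ordinal ib)) //=.
rewrite eqxx mul1r nth_index // big1 ?addr0 // => i /negPf ->.
by rewrite mul0r.
Qed.

Lemma quasi_commutative_right_noetherian : right_noetherian A.
Proof.
move=> I [I0 ID IM].
(* Multiplication in [A^c] is reversed, so [I] absorbs right factors of [A]. *)
have IMr (r x : A) : I x -> I (x * r) by exact: (IM r).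
have IZ c (x : A) : I x -> I (c *: x) by move=> /(IMr c%:A); rewrite mulr_algr.
have [|||||B BI Bgen] := @ideal_basis (fun U x => x * word_val U) I.
- by move=> U c x y; rewrite mulrDl scalerAl.
- move=> U W x /(belowMr U); apply: below_perm.
  by rewrite perm_catC.
- move=> U V; rewrite -word_val_cat.
  have [q q0 bq] : exists2 q : k, q != 0 &
      below (V ++ U) (word_val (V ++ U) - q *: word_val (U ++ V)).
    by apply: reorder_word; rewrite perm_catC.
  by exists q => //; apply: below_perm bq; rewrite perm_catC.
- by split.
- by move=> U x; apply: IMr.
exists (size B), (fun i => B`_i) => x; split=> [Ix|[r ->]]; last first.
  by elim/big_ind: _ => // i _; apply/IM/BI/mem_nth.
move: x Ix; apply: Bgen; first split.
- by exists (fun=> 0); rewrite big1 // => i _; rewrite mul0r.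
- move=> _ _ [r ->] [r' ->]; exists (fun i => r i + r' i).
  by rewrite -big_split; apply: eq_bigr => i _; rewrite mulrDl.
- move=> c _ [r ->]; exists (fun i => c *: (r i : A)).
  rewrite [LHS]scaler_sumr; apply: eq_bigr => i _.
  exact: (scalerAr c (B`_i : A) (r i)).
- move=> U _ [r ->]; exists (fun i => (r i : A) * word_val U).
  rewrite [LHS]mulr_suml; apply: eq_bigr => i _.
  exact: (esym (mulrA (B`_i : A) (r i) _)).
move=> b bB; have ib : (index b B < size B)%N by rewrite index_mem.
exists (fun i => (i == Ordinal ib)%:R); rewrite (bigD1 (Ordinal ib)) //=.
rewrite eqxx mul1r nth_index // big1 ?addr0 // => i /negPf ->.
by rewrite mul0r.
Qed.

End QuasiCommutative.

(** * Standard words *)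

Section WordOrder.
Variable n : nat.
Implicit Types s u v w x y : seq 'I_n.

Lemma size_gt0 u : u != [::] -> (0 < size u)%N.
Proof. by case: u. Qed.

Lemma wlt_irr u : wlt u u = false. Proof. exact: ltxx. Qed.
Lemma wle_refl u : wle u u. Proof. exact: lexx. Qed.
Lemma wltW u v : wlt u v -> wle u v. Proof. exact: ltW. Qed.

Lemma wlt_trans v u w : wlt u v -> wlt v w -> wlt u w.
Proof. by move=> uv vw; apply: lt_trans vw uv. Qed.

Lemma wle_trans v u w : wle u v -> wle v w -> wle u w.
Proof. by move=> uv vw; apply: le_trans vw uv. Qed.

Lemma wle_lt_trans v u w : wle u v -> wlt v w -> wlt u w.
Proof. by move=> uv vw; apply: lt_le_trans vw uv. Qed.

Lemma wlt_le_trans v u w : wlt u v -> wle v w -> wlt u w.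
Proof. by move=> uv vw; apply: le_lt_trans vw uv. Qed.

Lemma wle_anti u v : wle u v -> wle v u -> u = v.
Proof. by move=> uv vu; apply: (@le_anti _ (seqlexi 'I_n)); apply/andP. Qed.

Lemma wleNgt u v : wle u v = ~~ wlt v u. Proof. exact: leNgt. Qed.

Lemma wle_eqVlt u v : wle u v = (v == u) || wlt u v. Proof. exact: le_eqVlt. Qed.

Lemma wlt_cat2l s u v : wlt (s ++ u) (s ++ v) = wlt u v.
Proof. by elim: s => //= i s IH; rewrite /wlt /= ltxi_cons lexx. Qed.

Lemma wle_cat2l s u v : wle (s ++ u) (s ++ v) = wle u v.
Proof. by rewrite !wleNgt wlt_cat2l. Qed.

Lemma wle_prefix u v : wle (u ++ v) u.
Proof. by rewrite -[X in wle _ X]cats0 wle_cat2l. Qed.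

(** A comparison decided at a letter survives all continuations of both words; only that of a word
    with one of its prefixes can be reversed. *)
Lemma wlt_split u v : wlt u v ->
  (exists s, u = v ++ s) \/ forall x y, wlt (u ++ x) (v ++ y).
Proof.
elim: u v => [|i u IH] [|j v] //; first by left; exists (i :: u).
rewrite /wlt /= ltxi_cons => /andP[ji /implyP ij].
have [lt_ji|le_ij] := ltP j i.
  right=> x y; rewrite /wlt /= ltxi_cons ji /=; apply/implyP.
  by rewrite leNgt lt_ji.
have -> : j = i by apply/le_anti/andP.
have [[s ->]|] := IH _ (ij le_ij); first by left; exists s.
by move=> uv; right=> x y; rewrite /wlt /= ltxi_cons lexx; apply: uv.
Qed.

Lemma wlt_split_size u v x y : wlt u v -> (size u <= size v)%N ->
  wlt (u ++ x) (v ++ y).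
Proof.
move=> ltuv suv; have [[s us]|] := wlt_split ltuv; last exact.
have s0 : s = [::] by apply: size0nil; move: suv; rewrite us size_cat; lia.
by move: ltuv; rewrite us s0 cats0 wlt_irr.
Qed.

Lemma cat_eq_cat u v x y : u ++ v = x ++ y ->
  (exists s, u = x ++ s /\ y = s ++ v) \/ (exists s, x = u ++ s /\ v = s ++ y).
Proof.
elim: u x => [|i u IH] [|j x] /=.
- by move=> ->; left; exists [::].
- by move=> ->; right; exists (j :: x).
- by move=> <-; left; exists (i :: u).
- by move=> [<- /IH[[s [-> ->]]|[s [-> ->]]]]; [left | right]; exists s.
Qed.

Lemma wlt_max (l : seq (seq 'I_n)) : l != [::] ->
  exists2 w : seq 'I_n, w \in l & forall v : seq 'I_n, v \in l -> wle v w.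
Proof.
elim: l => // u [|u' l] IH _.
  by exists u; rewrite ?inE // => v; rewrite inE => /eqP->; exact: wle_refl.
have [//|w wl maxw] := IH.
have [uw|wu] := boolP (wle u w).
  exists w; first by rewrite inE wl orbT.
  by move=> v; rewrite inE => /orP[/eqP->|/maxw].
exists u; rewrite ?mem_head // => v; rewrite inE => /orP[/eqP->|/maxw vw].
  exact: wle_refl.
by apply: wle_trans vw _; apply: wltW; rewrite wleNgt negbK in wu.
Qed.

(** Otherwise either a letter decides and [u ++ v] is below its rotation [v ++ u], or
    [u ++ v = v ++ y] with [y] as long as [u]. In the latter case the first rotation gives [u < y],
    while the second gives [y ++ v < u ++ v], a contradiction. *)
Lemma standard_suffix u v : standard (u ++ v) -> u != [::] -> v != [::] ->
  wlt v (u ++ v).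
Proof.
case=> _ std u0 v0; have rot_uv := std u v erefl u0 v0.
rewrite -[wlt _ _]negbK -wleNgt wle_eqVlt; apply/negP => /orP[/eqP eqv|].
  by move/eqP: u0; apply; apply: size0nil; have := congr1 size eqv; rewrite size_cat; lia.
case/wlt_split=> [[y uvy]|/(_ [::] u)]; last first.
  by rewrite cats0 => /wlt_trans/(_ rot_uv); rewrite wlt_irr.
have suy : size y = size u by have := congr1 size uvy; rewrite !size_cat; lia.
have y0 : y != [::] by rewrite -size_eq0 suy size_eq0.
have lt_uy : wlt u y by move: rot_uv; rewrite uvy wlt_cat2l.
have := std v y uvy v0 y0 => /wlt_trans/(_ (wlt_split_size v v lt_uy _)).
by rewrite suy wlt_irr => /(_ (leqnn _)).
Qed.

(** Lyndon's criterion by proper suffixes takes the place of rotations; conversely, a rotation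
    [w ++ v] is at most its prefix [w]. *)
Lemma standardP u : standard u <-> u != [::] /\
  forall v w, u = v ++ w -> v != [::] -> w != [::] -> wlt w u.
Proof.
split=> [stdu|[u0 suff]]; split=> //; try by case: stdu.
  by move=> v w uvw; move: stdu; rewrite uvw; apply: standard_suffix.
move=> v w uvw v0 w0; apply: wle_lt_trans (suff v w uvw v0 w0).
exact: wle_prefix.
Qed.

(** A proper suffix of [u ++ v] is either a nonempty proper suffix of [u] followed by [v], already
    smaller at a letter of [u], or a suffix of [v], and [v] itself lies below [u ++ v]. *)
Lemma standard_cat u v : standard u -> standard v -> wlt v u ->
  standard (u ++ v).
Proof.
move=> stdu stdv vu; have [u0 suffu] := (standardP u).1 stdu.
have [v0 suffv] := (standardP v).1 stdv.
have v_uv : wlt v (u ++ v).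
  have [[y vuy]|/(_ [::] v)] := wlt_split vu; last by rewrite cats0.
  rewrite [X in wlt X _]vuy wlt_cat2l; apply: (suffv u y) => //.
  by apply: contraTneq vu => y0; rewrite vuy y0 cats0 wlt_irr.
apply/standardP; split=> [|x y]; first by case: (u) u0.
move=> uvxy x0 y0; have [[s [us ys]]|[s [xs vs]]] := cat_eq_cat uvxy.
  rewrite ys; have [->//|s0] := eqVneq s [::].
  apply: wlt_split_size (suffu x s us x0 s0) _.
  by rewrite us size_cat leq_addl.
have [s0|s0] := eqVneq s [::]; first by rewrite vs s0 in v_uv *.
by apply: wlt_trans v_uv; apply: suffv s0 y0.
Qed.

Lemma standard1 (i : 'I_n) : standard [:: i].
Proof.
apply/standardP; split=> // -[|j [|]] //= w [_ <-] //.
Qed.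

Implicit Type t : naword n.

Lemma na_standard_erase t : na_standard t -> standard (erase t).
Proof. by case: t => [i|v w] []. Qed.

Lemma erase_neq0 t : erase t != [::].
Proof. by elim: t => //= v IH w _; case: (erase v) IH. Qed.

Lemma erase_size t : (0 < size (erase t))%N.
Proof. by elim: t => //= v IH w _; rewrite size_cat ltn_addr. Qed.

(* The second factor of a standard bracketing is the greatest proper suffix of
   the word; this determines the bracketing. *)
Lemma na_standard_suffix t1 t2 v w : na_standard (Br t1 t2) ->
  erase t1 ++ erase t2 = v ++ w -> v != [::] -> w != [::] -> wle w (erase t2).
Proof.
elim: t1 t2 v w => [i|t11 IH t12 _] t2 v w.
  case=> _ [_ /na_standard_erase std2 _] /=.
  case: v => [//|j v] [_ e] _ w0; have [v0|v0] := eqVneq v [::].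
    by rewrite e v0 wle_refl.
  by move: std2; rewrite e => std2; apply: wltW; apply: standard_suffix.
case=> _ [std1 /na_standard_erase std2 cond] e v0 w0.
have [[s [t1s ws]]|[s [vs t2s]]] := cat_eq_cat e.
  have [s0|s0] := eqVneq s [::]; first by rewrite ws s0 wle_refl.
  rewrite ws; apply: wle_trans (wle_prefix _ _) _.
  by apply: wle_trans cond; apply: IH std1 t1s v0 s0.
have [s0|s0] := eqVneq s [::]; first by rewrite t2s s0 wle_refl.
by move: std2; rewrite t2s => std2; apply: wltW; apply: standard_suffix.
Qed.

Lemma na_standard_unique t t' : na_standard t -> na_standard t' ->
  erase t = erase t' -> t = t'.
Proof.
elim: t t' => [i|t1 IH1 t2 IH2] [j|t1' t2'] std std' e.
- by case: e => ->.
- have /= := congr1 size e; have := erase_size t1'; have := erase_size t2'.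
  by rewrite size_cat; lia.
- have /= := congr1 size e; have := erase_size t1; have := erase_size t2.
  by rewrite size_cat; lia.
have e2 : erase t2 = erase t2'.
  apply: wle_anti.
    exact: (na_standard_suffix std' (esym e) (erase_neq0 _) (erase_neq0 _)).
  exact: (na_standard_suffix std e (erase_neq0 _) (erase_neq0 _)).
have sz1 : size (erase t1) = size (erase t1').
  by have /= := congr1 size e; rewrite !size_cat e2; lia.
move/eqP: e; rewrite /= eqseq_cat // => /andP[/eqP e1 _].
case: std std' => _ [? ? _] [_ [? ? _]].
by rewrite (IH1 t1') // (IH2 t2').
Qed.

(** Split off the greatest proper suffix [w]. Its maximality makes both factors standard and forces
    the third clause: if [w < v2], then [v2 ++ w] would be a proper suffix exceeding [w]. *)
Lemma na_standard_exists u : standard u ->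
  exists2 t, na_standard t & erase t = u.
Proof.
have [m] := ubnP (size u); elim: m u => // m IH u; rewrite ltnS => su stdu.
have [u0 suffu] := (standardP u).1 stdu.
case: u u0 su stdu suffu => // i [|j u] _ su stdu suffu.
  by exists (Leaf i).
set u' := i :: j :: u in su stdu suffu *.
(* The shift [r.+1] excludes the whole word, and the bound [.-1] the empty suffix. *)
have [|w wl maxw] := @wlt_max [seq drop r.+1 u' | r <- iota 0 (size u').-1] => //.
have {}maxw x y : u' = x ++ y -> x != [::] -> y != [::] -> wle y w.
  move=> uxy x0 y0; apply: maxw; apply/mapP; exists (size x).-1.
    rewrite mem_iota uxy size_cat; have := size_gt0 x0; have := size_gt0 y0; lia.
  by rewrite uxy prednK ?drop_size_cat // lt0n size_eq0.
case/mapP: wl => r; rewrite mem_iota => r_lt def_w.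
set v := take r.+1 u'; have uvw : u' = v ++ w by rewrite def_w cat_take_drop.
have v0 : v != [::] by [].
have w0 : w != [::].
  apply/eqP => w0; have := size_drop r.+1 u'; rewrite -def_w w0 /=.
  by move: r_lt; rewrite /=; lia.
clearbody v; clear def_w r_lt r; clearbody u'.
have suvw : size u' = (size v + size w)%N by rewrite uvw size_cat.
have stdw : standard w.
  apply/standardP; split=> // x y wxy x0 y0.
  have : wle y w.
    apply: (maxw (v ++ x)) => //; first by rewrite -catA -wxy.
    by case: (v) v0.
  rewrite wle_eqVlt => /orP[/eqP wy|//]; have := size_gt0 x0.
  by have := congr1 size wxy; rewrite size_cat wy; lia.
have stdv : standard v.
  apply/standardP; split=> // x y vxy x0 y0.
  have yw_u : wlt (y ++ w) u'.
    apply: (suffu x) => //; first by rewrite uvw vxy catA.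
    by case: (y) y0.
  rewrite -[wlt _ _]negbK -wleNgt wle_eqVlt; apply/negP => /orP[/eqP yv|].
    by have := size_gt0 x0; have := congr1 size vxy; rewrite size_cat yv; lia.
  case/wlt_split=> [[s vs]|/(_ w w)]; last first.
    by rewrite -uvw => /wlt_trans/(_ yw_u); rewrite wlt_irr.
  (* With [v = y ++ s], cancelling [y] gives [w < s ++ w], against the choice of [w]. *)
  move: yw_u; rewrite uvw vs -catA wlt_cat2l; apply/negP; rewrite -wleNgt.
  apply: (maxw y); first by rewrite uvw vs catA.
    by [].
  by case: (s).
have sv : (size v < m)%N.
  by apply: leq_trans su; rewrite suvw; have := size_gt0 w0; lia.
have sw : (size w < m)%N.
  by apply: leq_trans su; rewrite suvw; have := size_gt0 v0; lia.
have [tv stdtv ev] := IH v sv stdv; have [tw stdtw ew] := IH w sw stdw.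
exists (Br tv tw); last by rewrite /= ev ew uvw.
rewrite /= ev ew -uvw; split=> //; split=> //.
case: tv stdtv ev => // t1 t2 _ /= ev; rewrite wleNgt; apply/negP => w_t2.
have t2w_w : wle (erase t2 ++ w) w.
  apply: (maxw (erase t1)); rewrite ?erase_neq0 //; first by rewrite catA ev uvw.
  by case: (erase t2) (erase_neq0 t2).
case: (wlt_split w_t2) => [[y wy]|/(_ [::] w)]; last first.
  by rewrite cats0 => /wle_lt_trans - /(_ _ t2w_w); rewrite wlt_irr.
move: t2w_w; rewrite [X in wle _ X]wy wle_cat2l wleNgt => /negP; apply.
have y0 : y != [::].
  by apply: contraTneq w_t2 => y0; rewrite wy y0 cats0 wlt_irr.
rewrite [X in wlt _ X]wy; apply: standard_suffix; rewrite -?wy ?erase_neq0 //.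
Qed.

End WordOrder.

(** * Skew commutators of super-letters *)

Lemma character1 (G : groupType) (k : fieldType) (chi : G -> k) :
  is_character chi -> chi 1%g = 1.
Proof.
case=> chi0 chiM; apply: (mulfI (chi0 1%g)).
by rewrite -chiM mulr1 mul1g.
Qed.

Section SkewCommutators.
Variables (k : fieldType) (H : hopfAlgType k) (n : nat).
Variable a : 'I_n -> H.
Variables (g : 'I_n -> grouplikes H) (chi : 'I_n -> grouplikes H -> k).
Hypothesis chi_char : forall i, is_character (chi i).
Implicit Types u v w : seq 'I_n.
Implicit Types (W : seq (seq 'I_n)) (h : grouplikes H) (x y z : H).

Local Notation p := (pword g chi).
Local Notation SL := (superletter a g chi).
Local Notation SW := (sw_val a g chi).

(** In this form [p] is visibly multiplicative in both arguments and depends only on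
    constitutions. *)
Lemma pwordE u v : p u v = \prod_(i <- u) \prod_(j <- v) chi i (g j).
Proof.
rewrite /pword /chiword; apply: eq_bigr => i _; rewrite /gword.
elim: v => [|j v IH]; first by rewrite !big_nil (character1 (chi_char i)).
by rewrite !big_cons -IH (chi_char i).2.
Qed.

Lemma pword_catl u u' v : p (u ++ u') v = p u v * p u' v.
Proof. exact: big_cat. Qed.

Lemma pword_catr u v v' : p u (v ++ v') = p u v * p u v'.
Proof. by rewrite !pwordE -big_split; apply: eq_bigr => i _; rewrite big_cat. Qed.

Lemma pword_nilr u : p u [::] = 1.
Proof. by rewrite pwordE big1 // => i _; rewrite big_nil. Qed.

Lemma pword_permr u v v' : perm_eq v v' -> p u v = p u v'.
Proof.
by move=> vv'; rewrite !pwordE; apply: eq_bigr => i _; apply: perm_big.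
Qed.

Lemma chiword_neq0 u h : chiword chi u h != 0.
Proof. by rewrite prodf_seq_neq0; apply/allP => i _; apply: (chi_char i).1. Qed.

Lemma chiword_cat u v h : chiword chi (u ++ v) h = chiword chi u h * chiword chi v h.
Proof. exact: big_cat. Qed.

Lemma superletterE t : na_standard t -> SL (erase t) = na_eval a g chi t.
Proof.
move=> stdt; rewrite /superletter.
have : exists x, exists t',
    [/\ na_standard t', erase t' = erase t & x = na_eval a g chi t'].
  by exists (na_eval a g chi t), t.
move=> /(xgetPex 0) [t' [stdt' et' ->]].
by rewrite (na_standard_unique stdt' stdt et').
Qed.

Definition skew u v x y : H := x * y - p u v *: (y * x).

Lemma skew_jacobi u1 u2 v x y z :
  skew (u1 ++ u2) v (skew u1 u2 x y) z =
  skew u1 (u2 ++ v) x (skew u2 v y z)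
    + p u2 v *: (skew u1 v x z * y) - p u1 u2 *: (y * skew u1 v x z).
Proof.
have zmod_id (e1 e2 e3 e4 e5 e6 : H) : e1 - e2 - (e3 - e4) =
    e1 - e5 - (e6 - e4) + (e5 - e3) - (e2 - e6).
  rewrite !opprB [e1 - e5 + _ + _]addrAC subrKA -[RHS]addrA subrKA.
  by rewrite addrACA [- e2 - e3]addrC -addrACA.
(* The two extra terms supplied to [zmod_id] are the monomials in [x * z * y] and [y * z * x], which
   cancel among the commutators on the right. *)
rewrite /skew pword_catl pword_catr.
rewrite !(mulrBl, mulrBr, scalerBr) -!(scalerAl, scalerAr) !scalerA !mulrA.
rewrite (zmod_id _ _ _ _ (p u2 v *: (x * z * y)) ((p u1 u2 * p u1 v) *: (y * z * x))).
rewrite -(mulrA (p u1 u2)) (mulrC (p u2 v) (p u1 v)).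
by rewrite (mulrC (p u1 u2) (p u1 v * p u2 v)).
Qed.

(** Commutation with [x] is a twisted derivation; this reduces commutators with super-words to those
    with single super-letters. *)
Lemma skew_leibniz u v w x y z :
  skew u (v ++ w) x (y * z) =
  skew u v x y * z + p u v *: (y * skew u w x z).
Proof.
rewrite /skew pword_catr mulrBl mulrBr scalerBr -!scalerAl -!scalerAr !mulrA.
by rewrite scalerA subrKA.
Qed.

(** The last hypothesis is the third clause of standardness, so joining the bracketings of [u] and
    [v] gives the standard bracketing of [u ++ v]. *)
Lemma superletter_cat t u v : na_standard t -> erase t = u -> standard v -> wlt v u ->
    (if t is Br _ t2 then wle (erase t2) v else true) ->
  SL (u ++ v) = skew u v (SL u) (SL v).
Proof.
move=> stdt <- stdv vt cond; have [t' stdt' et'] := na_standard_exists stdv.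
rewrite -et' -[_ ++ _]/(erase (Br t t')) superletterE /=; last first.
  rewrite et'; split; first exact: standard_cat (na_standard_erase stdt) stdv vt.
  by case: t stdt cond {vt} => // t1 t2 stdt cond; split; rewrite ?et'.
by rewrite !superletterE.
Qed.

(** Words have equal constitutions exactly when they are permutations of each other, hence [perm_eq]
    on the flattened super-word. *)
Definition constituted u b : H -> Prop := fun x => exists W,
  [/\ superword W, perm_eq (flatten W) u, forall w, w \in W -> wle w b & x = SW W].

Lemma constitutedM u v b x y :
    lspan (constituted u b) x -> lspan (constituted v b) y ->
  lspan (constituted (u ++ v) b) (x * y).
Proof.
apply: lspanM => {}x {}y [W [sW Wu Wb ->]] [W' [sW' W'v W'b ->]].
apply: lspan_gen; exists (W ++ W'); split.
- by move=> w; rewrite mem_cat => /orP[/sW|/sW'].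
- by rewrite flatten_cat perm_cat.
- by move=> w; rewrite mem_cat => /orP[/Wb|/W'b].
- by rewrite /sw_val big_cat.
Qed.

Lemma constituted_le u b b' x : wle b b' ->
  lspan (constituted u b) x -> lspan (constituted u b') x.
Proof.
move=> bb'; apply: lspan_sub => y [W [sW Wu Wb ->]].
apply: lspan_gen; exists W; split=> // w /Wb wb; exact: wle_trans bb'.
Qed.

Lemma constituted_perm u u' b x : perm_eq u u' ->
  lspan (constituted u b) x -> lspan (constituted u' b) x.
Proof.
move=> uu'; apply: lspan_sub => y [W [sW Wu Wb ->]].
by apply: lspan_gen; exists W; split=> //; apply: perm_trans uu'.
Qed.

Lemma constituted_superletter u b : standard u -> wle u b ->
  lspan (constituted u b) (SL u).
Proof.
move=> stdu ub; apply: lspan_gen; exists [:: u]; split.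
- by move=> w; rewrite inE => /eqP->.
- by rewrite /= cats0.
- by move=> w; rewrite inE => /eqP->.
- by rewrite /sw_val big_seq1.
Qed.

Lemma skew_superword u b x W : superword W ->
    (forall w, w \in W ->
       wle w b /\ lspan (constituted (u ++ w) b) (skew u w x (SL w))) ->
  lspan (constituted (u ++ flatten W) b) (skew u (flatten W) x (SW W)).
Proof.
elim: W => [|w W IH] sW Wb.
  rewrite /skew /sw_val big_nil pword_nilr mulr1 mul1r scale1r subrr.
  exact: lspan0.
rewrite /sw_val big_cons -/(SW W) /= skew_leibniz; apply: lspanD.
  rewrite catA; apply: constitutedM.
    by have [] := Wb w (mem_head _ _).
  apply: lspan_gen; exists W; split=> // v vW; first by apply: sW; rewrite inE vW orbT.
  by have [] := Wb v; rewrite ?inE ?vW ?orbT.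
apply: lspanZ; apply: (@constituted_perm (w ++ (u ++ flatten W))).
  by rewrite perm_catCA.
apply: constitutedM.
  apply: constituted_superletter; first exact: sW (mem_head _ _).
  by have [] := Wb w (mem_head _ _).
apply: IH => v vW; first by apply: sW; rewrite inE vW orbT.
by apply: Wb; rewrite inE vW orbT.
Qed.

Lemma skew_linear u v x c y z :
  skew u v x (c *: y + z) = c *: skew u v x y + skew u v x z.
Proof.
rewrite /skew mulrDr mulrDl -scalerAl -scalerAr scalerDr scalerBr !scalerA.
by rewrite (mulrC c) opprD addrACA.
Qed.

(* If [[u][v]] is not itself the super-letter [uv], then [u] = [[u1][u2]] with
   v < u2, and the skew Jacobi identity leads to [[u1][[u2][v]]] and [[u1][v]].
   In [[u1][w]] with w a letter of [[u2][v]], the total length may not drop, but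
   the first word does; w <= u2 v then gives u1 w <= u1 u2 v. *)
Lemma skew_superletters u v : standard u -> standard v -> wlt v u ->
  lspan (constituted (u ++ v) (u ++ v)) (skew u v (SL u) (SL v)).
Proof.
have [N] := ubnP (size (u ++ v)); elim: N u v => // N IHN u v.
have [M] := ubnP (size u); elim: M u v => // M IHM u v; rewrite !ltnS.
move=> leM leN stdu stdv ltvu.
have [t stdt et] := na_standard_exists stdu.
have stduv := standard_cat stdu stdv ltvu.
have [cond|] := boolP (if t is Br _ t2 then wle (erase t2) v else true).
  rewrite -(superletter_cat stdt et stdv ltvu cond).
  by apply: constituted_superletter; rewrite ?wle_refl.
case: t stdt et => // t1 t2 stdt /= et; rewrite wleNgt negbK => ltvu2.
have [_ [stdt1 stdt2 _]] := stdt.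
have := superletterE stdt; rewrite /= et -!superletterE //.
set u1 := erase t1 in et *; set u2 := erase t2 in et ltvu2 *.
rewrite -/(skew u1 u2 (SL u1) (SL u2)) => ->.
have std1 : standard u1 by exact: na_standard_erase.
have std2 : standard u2 by exact: na_standard_erase.
have s1 : (0 < size u1)%N by exact: erase_size.
have s2 : (0 < size u2)%N by exact: erase_size.
have su : size u = (size u1 + size u2)%N by rewrite -et size_cat.
have u2u : wlt u2 u by rewrite -et standard_suffix ?erase_neq0 // et.
have u21 : wlt u2 u1 by apply: wlt_le_trans u2u _; rewrite -et wle_prefix.
(* As [u2] is no longer than [u], the comparison is decided at a letter and survives
   continuations. *)
have u2_uv w : wlt (u2 ++ w) (u ++ v).
  by apply: wlt_split_size u2u _; rewrite su leq_addl.
have std2v := standard_cat std2 stdv ltvu2.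
have v_2v : wlt v (u2 ++ v).
  by apply: standard_suffix; rewrite ?erase_neq0 //; case: stdv.
have sN : (size u + size v <= N)%N by rewrite -size_cat.
have skew1v : lspan (constituted (u1 ++ v) (u ++ v)) (skew u1 v (SL u1) (SL v)).
  apply: (@constituted_le _ (u1 ++ v)).
    by rewrite -et -catA wle_cat2l; apply: wltW.
  apply: IHN => //; first by rewrite size_cat; lia.
  exact: wlt_trans u21.
have SL2 : lspan (constituted u2 (u ++ v)) (SL u2).
  apply: constituted_superletter => //; apply: wltW.
  by rewrite -[u2]cats0.
rewrite -[X in skew X]et skew_jacobi; apply: lspanB; first apply: lspanD.
(* The outer induction expands [[u2][v]] in super-letters up to [u2 ++ v]; the Leibniz rule then
   distributes [u1] over each super-word. *)
- have : lspan (constituted (u2 ++ v) (u2 ++ v)) (skew u2 v (SL u2) (SL v)).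
    by apply: IHN => //; rewrite size_cat; lia.
  elim=> [|c _ x [W [sW Wuv Wb ->]] _ IH].
    by rewrite /skew mulr0 mul0r scaler0 subrr; exact: lspan0.
  rewrite skew_linear; apply: lspanD => //; apply: lspanZ.
  have -> : skew u1 (u2 ++ v) (SL u1) (SW W) = skew u1 (flatten W) (SL u1) (SW W).
    by rewrite /skew (pword_permr _ Wuv).
  apply: (@constituted_perm (u1 ++ flatten W)).
    by rewrite -et -catA perm_cat2l.
  apply: skew_superword => // w wW; have wb := Wb w wW; split.
    exact: wle_trans wb (wltW (u2_uv v)).
  apply: (@constituted_le _ (u1 ++ w)).
    by rewrite -et -catA wle_cat2l.
  have sw : (size w <= size u2 + size v)%N.
    rewrite -size_cat -(perm_size Wuv) size_flatten.
    case/splitPr: wW => W1 W2; rewrite /shape map_cat sumn_cat /=; lia.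
  apply: IHM => //.
  - by lia.
  - by rewrite size_cat; lia.
  - exact: sW.
  - apply: wle_lt_trans wb _; apply: wle_lt_trans u21; exact: wle_prefix.
- apply: lspanZ; apply: (@constituted_perm ((u1 ++ v) ++ u2)).
    by rewrite -et -!catA perm_cat2l perm_catC.
  exact: constitutedM.
apply: lspanZ; apply: (@constituted_perm (u2 ++ (u1 ++ v))).
  by rewrite -et catA perm_cat2r perm_catC.
exact: constitutedM.
Qed.

End SkewCommutators.

(** * Reduction to hard super-letters *)

(** Words have no negative exponents, so the inverses join the generators; a quotient of two
    products is then again a product. *)
Lemma group_generators_word (G : groupType) (s : seq G) (h : G) :
    (forall S : {pred G}, group_closed S -> {subset s <= S} -> forall x, x \in S) ->
  exists2 l : seq G, {subset l <= s ++ [seq x^-1 | x <- s]%g} & h = (\prod_(x <- l) x)%g.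
Proof.
move=> gen; pose S : {pred G} := fun h =>
  `[< exists2 l : seq G, {subset l <= s ++ [seq x^-1 | x <- s]%g} &
        h = (\prod_(x <- l) x)%g >].
suff /asboolP : h \in S by [].
apply: gen => [|x xs]; last first.
  apply/asboolP; exists [:: x]; last by rewrite big_seq1.
  by move=> y; rewrite inE => /eqP->; rewrite mem_cat xs.
split; first by apply/asboolP; exists [::]; rewrite ?big_nil.
move=> _ _ /asboolP[l ls ->] /asboolP[l' l's ->]; apply/asboolP.
exists (l ++ rev [seq x^-1 | x <- l']%g).
  move=> x; rewrite mem_cat mem_rev => /orP[/ls//|/mapP[y /l's ys ->]].
  move: ys; rewrite !mem_cat => /orP[ys|/mapP[z zs ->]].
    by rewrite map_f ?orbT.
  by rewrite invgK zs.
rewrite big_cat /=; congr (_ * _)%g.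
elim: l' {l's} => [|x l' IH]; first by rewrite !big_nil invg1.
by rewrite map_cons rev_cons -cats1 big_cat /= big_seq1 big_cons -IH invgM.
Qed.

Section HardReduction.
Variables (k : fieldType) (H : hopfAlgType k) (n : nat).
Variables (a : 'I_n -> H) (d : 'I_n -> nat).
Variables (g : 'I_n -> grouplikes H) (chi : 'I_n -> grouplikes H -> k).
Hypothesis chi_char : forall i, is_character (chi i).
Hypothesis semi_inv : forall i (h : grouplikes H),
  a i * val h = chi i h *: (val h * a i).
Hypothesis d_gt0 : forall i, (0 < d i)%N.
Implicit Types u v w b : seq 'I_n.
Implicit Types (W : seq (seq 'I_n)) (h : grouplikes H) (x y z : H).

Local Notation p := (pword g chi).
Local Notation SL := (superletter a g chi).
Local Notation SW := (sw_val a g chi).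
Local Notation hard := (hard a d g chi).

Lemma na_eval_semi_inv t h : na_eval a g chi t * val h =
  chiword chi (erase t) h *: (val h * na_eval a g chi t).
Proof.
elim: t => [i|t1 IH1 t2 IH2] /=; first by rewrite /chiword big_seq1 semi_inv.
have swap x y c e : x * val h = c *: (val h * x) -> y * val h = e *: (val h * y) ->
    x * y * val h = (c * e) *: (val h * (x * y)).
  move=> hx hy; rewrite -mulrA hy -scalerAr (mulrA x) hx -scalerAl scalerA.
  by rewrite mulrC mulrA.
rewrite mulrBl -scalerAl (swap _ _ _ _ IH1 IH2) (swap _ _ _ _ IH2 IH1).
rewrite chiword_cat mulrBr scalerBr -scalerAr !scalerA.
by congr (_ - _ *: _); rewrite mulrC (mulrC (chiword _ (erase t2) h)).
Qed.

Lemma superletter_semi_inv u h : standard u ->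
  SL u * val h = chiword chi u h *: (val h * SL u).
Proof.
move=> /na_standard_exists[t stdt <-]; rewrite superletterE //.
exact: na_eval_semi_inv.
Qed.

Lemma superword_semi_inv W h : superword W ->
  SW W * val h = chiword chi (flatten W) h *: (val h * SW W).
Proof.
elim: W => [|w W IH] sW.
  by rewrite /sw_val /chiword !big_nil mul1r mulr1 scale1r.
rewrite /sw_val big_cons -/(SW W) /= chiword_cat -mulrA IH; last first.
  by move=> v vW; apply: sW; rewrite inE vW orbT.
rewrite -scalerAr (mulrA _ (val h)) superletter_semi_inv; last exact: sW (mem_head _ _).
by rewrite -scalerAl scalerA mulrA (mulrC (chiword _ w h)).
Qed.

(** Normal forms of degree at most [D]: the bound [b] restricts the super-letters of the top-degree
    part only. *)
Definition reduced (D : nat) b : H -> Prop := fun x => exists h W,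
  [/\ forall w, w \in W -> hard w,
      (sw_deg d W < D)%N \/ sw_deg d W = D /\ forall w, w \in W -> wle w b
    & x = val h * SW W].

Lemma hard_superword W : (forall w, w \in W -> hard w) -> superword W.
Proof. by move=> hW w /hW[]. Qed.

Lemma sw_deg_cat W W' : sw_deg d (W ++ W') = (sw_deg d W + sw_deg d W')%N.
Proof. exact: big_cat. Qed.

(** Semi-invariance carries the second group element leftwards through the first super-word, at the
    cost of a scalar. *)
Lemma reducedM D D' b x y : lspan (reduced D b) x -> lspan (reduced D' b) y ->
  lspan (reduced (D + D') b) (x * y).
Proof.
apply: lspanM => {}x {}y [h [W [hW dW ->]]] [h' [W' [hW' dW' ->]]].
rewrite mulrA -(mulrA (val h)) superword_semi_inv; last exact: hard_superword.
rewrite -scalerAr -scalerAl; apply/lspanZ/lspan_gen.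
exists (h * h')%g, (W ++ W'); split.
- by move=> w; rewrite mem_cat => /orP[/hW|/hW'].
- rewrite sw_deg_cat; case: dW => [ltW|[-> Wb]]; case: dW' => [ltW'|[-> W'b]].
  + by left; lia.
  + by left; lia.
  + by left; lia.
  by right; split=> // w; rewrite mem_cat => /orP[/Wb|/W'b].
by rewrite /sw_val big_cat /= !mulrA.
Qed.

Lemma reduced_ltn D D' b b' x : (D < D')%N ->
  lspan (reduced D b) x -> lspan (reduced D' b') x.
Proof.
move=> ltD; apply: lspan_sub => y [h [W [hW dW ->]]]; apply: lspan_gen.
by exists h, W; split=> //; left; case: dW => [|[-> _]] //; lia.
Qed.

Lemma reduced_wle D b b' x : wle b b' ->
  lspan (reduced D b) x -> lspan (reduced D b') x.
Proof.
move=> bb'; apply: lspan_sub => y [h [W [hW dW ->]]]; apply: lspan_gen.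
exists h, W; split=> //; case: dW => [|[dW Wb]]; first by left.
by right; split=> // w /Wb wb; apply: wle_trans bb'.
Qed.

Lemma reduced_grouplike h b : lspan (reduced 0 b) (val h).
Proof.
apply: lspan_gen; exists h, [::]; split=> //.
  by right; rewrite /sw_deg big_nil.
by rewrite /sw_val big_nil mulr1.
Qed.

Lemma reduced_superword W b :
    (forall w, w \in W -> wle w b /\ lspan (reduced (wdeg d w) w) (SL w)) ->
  lspan (reduced (sw_deg d W) b) (SW W).
Proof.
elim: W => [|w W IH] Wb.
  rewrite /sw_deg /sw_val !big_nil.
  exact: (reduced_grouplike (1%g : grouplikes H)).
rewrite /sw_deg /sw_val !big_cons; apply: reducedM.
  by have [wb] := Wb w (mem_head _ _); apply: reduced_wle.
by apply: IH => v vW; apply: Wb; rewrite inE vW orbT.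
Qed.

Lemma size_wdeg u : (size u <= wdeg d u)%N.
Proof.
rewrite /wdeg -sum1_size; apply: leq_sum => i _; exact: d_gt0.
Qed.

Lemma wdeg_sw_deg w W : w \in W -> (wdeg d w <= sw_deg d W)%N.
Proof.
by move=> wW; rewrite /sw_deg (big_rem _ wW) /= leq_addr.
Qed.

(** Positive letter degrees bound the length of a word by its degree, so below a word there are only
    finitely many words of the same degree. *)
Lemma wlt_degree_ind (P : seq 'I_n -> Prop) :
    (forall u, (forall v, (wdeg d v < wdeg d u)%N -> P v) ->
       (forall v, wdeg d v = wdeg d u -> wlt v u -> P v) -> P u) ->
  forall u, P u.
Proof.
move=> IH u; have [N] := ubnP (wdeg d u); elim: N u => // N IHN u; rewrite ltnS.
pose lower u := [set v : {bseq N of 'I_n} | wlt v u].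
have [m] := ubnP #|lower u|; elim: m u => // m IHm u; rewrite ltnS => le_m le_N.
apply: IH => [v ltvu|v eqvu ltvu]; first by apply: IHN; apply: leq_trans le_N.
have sv : (size v <= N)%N.
  by apply: leq_trans le_N; rewrite -eqvu size_wdeg.
apply: IHm; last by rewrite eqvu.
apply: leq_trans le_m; apply: proper_card; apply/properP; split.
  by apply/fintype.subsetP => w; rewrite !inE => /wlt_trans; apply.
by exists (Bseq sv); rewrite !inE ?wlt_irr.
Qed.

(** A super-letter that is not hard is expanded by definition; every super-letter obtained has
    smaller degree, or the same degree and a smaller word, so the expansion can be repeated and
    terminates. *)
Lemma superletter_reduced u : standard u -> lspan (reduced (wdeg d u) u) (SL u).
Proof.
elim/wlt_degree_ind: u => u IHdeg IHlt stdu.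
have [hu|nhu] := EM (hard u).
  apply: lspan_gen; exists 1%g, [:: u]; split.
  - by move=> w; rewrite inE => /eqP->.
  - right; rewrite /sw_deg big_seq1; split=> // w.
    by rewrite inE => /eqP->; exact: wle_refl.
  by rewrite /sw_val big_seq1 mul1r.
have : lin_comb_of
      ([set x | exists W, [/\ superword W, sw_deg d W = wdeg d u,
                              forall v, v \in W -> wlt v u & x = SW W]]
       `|`
       [set x | exists (h : grouplikes H) W,
                  [/\ superword W, (sw_deg d W < wdeg d u)%N
                    & x = val h * SW W]])%classic (SL u).
  by apply: contrapT => nlin; apply: nhu; split.
move/lspan_lin_comb; apply: lspan_sub => _ [[W [sW dW Wu ->]]|[h [W [sW dW ->]]]].
  rewrite -dW; apply: reduced_superword => w wW; split; first exact/wltW/Wu.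
  have := wdeg_sw_deg wW; rewrite dW leq_eqVlt => /orP[/eqP eqw|ltw].
    by apply: IHlt => //; [exact: Wu | exact: sW].
  by apply: IHdeg => //; exact: sW.
(* The empty word is the greatest word, so as a bound it imposes nothing. *)
apply: (@reduced_ltn (0 + sw_deg d W) _ [::]) => //.
apply: reducedM; first exact: reduced_grouplike.
apply: reduced_superword => w wW; split; first exact: (wle_prefix [::]).
apply: IHdeg; last exact: sW.
exact: leq_ltn_trans (wdeg_sw_deg wW) dW.
Qed.

(** Equal constitutions have equal degrees, so the super-letters of the commutator are reduced one
    by one within the same degree and bound. *)
Lemma skew_reduced u v : standard u -> standard v -> wlt v u ->
  lspan (reduced (wdeg d u + wdeg d v) (u ++ v)) (skew g chi u v (SL u) (SL v)).
Proof.
move=> stdu stdv ltvu; have := skew_superletters a g chi_char stdu stdv ltvu.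
apply: lspan_sub.
move=> _ [W [sW Wuv Wb ->]].
have -> : (wdeg d u + wdeg d v)%N = sw_deg d W.
  rewrite -[LHS]big_cat -(perm_big _ Wuv) /= /sw_deg.
  exact: big_flatten.
apply: reduced_superword => w wW; split; first exact: Wb.
exact/superletter_reduced/sW.
Qed.

End HardReduction.

(** * Hard super-letters and group generators as quasi-commuting letters *)

Theorem corollary5 (k : fieldType) (H : hopfAlgType k) (n : nat)
    (a : 'I_n -> H) (d : 'I_n -> nat)
    (g : 'I_n -> grouplikes H) (chi : 'I_n -> grouplikes H -> k) :
  abelian_group (grouplikes H) ->
  (forall i, skew_primitive_semi_invariant (a i) (g i) (chi i)) ->
  generates_algebra ([set x | grouplike x] `|` range a)%classic ->
  (forall i, 0 < d i)%N ->
  finite_set [set u | hard a d g chi u]%classic ->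
  fin_generated_group (grouplikes H) ->
  left_noetherian H /\ right_noetherian H.
Proof.
move=> abG skp genH d_gt0 /finite_seqP[s0 hard_s0] [gs0 gen_gs0].
have chi_char i : is_character (chi i) by have [] := skp i.
have semi_inv i (h : grouplikes H) : a i * val h = chi i h *: (val h * a i).
  by have [] := skp i.
(* Decreasing order gives the greatest super-letters the smallest ranks, which makes them the most
   significant. *)
pose s := sort (fun u v => wle v u) (undup s0).
have hardE u : hard a d g chi u <-> u \in s.
  by rewrite mem_sort mem_undup; move: hard_s0 => /seteqP[h1 h2]; split=> [/h1|/h2].
pose gs := gs0 ++ [seq x^-1 | x <- gs0]%g.
pose T := ('I_(size s) + 'I_(size gs))%type.
pose w_ (i : 'I_(size s)) : seq 'I_n := nth [::] s i.
pose g_ (j : 'I_(size gs)) : grouplikes H := nth 1%g gs j.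
pose z (t : T) : H := match t with
  inl i => superletter a g chi (w_ i) | inr j => val (g_ j) end.
pose deg (t : T) : nat := match t with inl i => wdeg d (w_ i) | inr j => 0%N end.
pose rank (t : T) : nat := match t with inl i => i | inr j => (size s + j)%N end.
have rank_inj : injective rank.
  move=> [i|j] [i'|j'] /=; have := @ltn_ord (size s).
  - by move=> _ /val_inj ->.
  - by move=> /(_ i); lia.
  - by move=> /(_ i'); lia.
  - by move=> _ /addnI/val_inj ->.
have w_hard i : hard a d g chi (w_ i) by apply/hardE; rewrite mem_nth.
have w_std i : standard (w_ i) by case: (w_hard i).
have w_lt (i j : 'I_(size s)) : (i < j)%N -> wlt (w_ j) (w_ i).
  move=> lt_ij; have := wle_eqVlt (w_ j) (w_ i).
  have -> : wle (w_ j) (w_ i).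
    have s_sorted : sorted (fun u v => wle v u) s.
      by apply: sort_sorted => u v; apply: le_total.
    have wge_trans : transitive (fun u v : seq 'I_n => wle v u).
      by move=> v u w uv vw; apply: wle_trans vw uv.
    by apply: (sorted_ltn_nth wge_trans [::] s_sorted); rewrite ?inE.
  rewrite /w_ nth_uniq ?sort_uniq ?undup_uniq // => /esym /orP[/eqP eqij|//].
  by rewrite eqij ltnn in lt_ij.
have group_word (h : grouplikes H) : exists l : seq 'I_(size gs),
    val h = word_val z (map inr l).
  have [l lgs ->] := group_generators_word h gen_gs0.
  elim: l lgs => [|x l IH] lgs.
    by exists [::]; rewrite /word_val !big_nil.
  have [|l' el] := IH; first by move=> y yl; apply: lgs; rewrite inE yl orbT.
  have xgs : (index x gs < size gs)%N by rewrite index_mem lgs ?mem_head.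
  exists (Ordinal xgs :: l').
  by rewrite map_cons word_val_cons -el big_cons /= /g_ nth_index // -index_mem.
have hard_word (W : seq (seq 'I_n)) : (forall w, w \in W -> hard a d g chi w) ->
    exists l : seq 'I_(size s), W = map w_ l.
  elim: W => [|w W IH] hW; first by exists [::].
  have [|l el] := IH; first by move=> v vW; apply: hW; rewrite inE vW orbT.
  have ws : w \in s by apply/hardE/hW/mem_head.
  have iw : (index w s < size s)%N by rewrite index_mem.
  by exists (Ordinal iw :: l); rewrite map_cons -el /w_ /= nth_index.
have reduced_word D b x : reduced a d g chi D b x -> exists l (l' : seq 'I_(size s)),
    [/\ (\sum_(i <- l') wdeg d (w_ i) < D)%N \/
        (\sum_(i <- l') wdeg d (w_ i))%N = D /\ forall i, i \in l' -> wle (w_ i) b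
      & x = word_val z (map inr l ++ map inl l')].
  move=> [h [W [/hard_word[l' ->] dW ->]]]; have [l el] := group_word h.
  exists l, l'; split; last first.
    by rewrite word_val_cat el /sw_val /word_val !big_map.
  case: dW; rewrite /sw_deg big_map; first by left.
  by move=> [-> Wb]; right; split=> // i il; apply/Wb/map_f.
have span x : lspan (fun y => exists W, y = word_val z W) x.
  pose S : {pred H} := fun x => `[< lspan (fun y => exists W, y = word_val z W) x >].
  suff /asboolP : x \in S by [].
  apply: genH => [|{}x]; first split.
  - by apply/asboolP/lspan_gen; exists [::]; rewrite /word_val big_nil.
  - move=> c x' y /asboolP Sx /asboolP Sy; apply/asboolP.
    by apply: lspanD => //; apply: lspanZ.
  - move=> x' y /asboolP Sx /asboolP Sy; apply/asboolP.
    apply: lspanM Sx Sy => _ _ [W ->] [W' ->]; apply: lspan_gen.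
    by exists (W ++ W'); rewrite word_val_cat.
  case=> [gx|[i _ <-]]; apply/asboolP.
    have [l el] := group_word (Sub x gx).
    by apply: lspan_gen; exists (map inr l); rewrite -el.
  (* The generator [a i] is the super-letter of a one-letter word. *)
  have := superletter_reduced g semi_inv d_gt0 (standard1 i).
  rewrite -[[:: i]]/(erase (Leaf i)) superletterE /=; last first.
    by split=> //; exact: standard1.
  apply: lspan_sub => y /reduced_word[l [l' [_ ->]]].
  by apply: lspan_gen; exists (map inr l ++ map inl l').
have commutation (t t' : T) : (rank t < rank t')%N -> exists2 q : k, q != 0 &
    below rank deg z [:: t; t'] (z t * z t' - q *: (z t' * z t)).
  (* Group generators rank after all super-letters. The last three cases are therefore
     semi-invariance, an impossible order of ranks, and commutativity of the group. *)
  case: t t' => [i|j] [i'|j'] /= lt_rank; last 3 first.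
  - exists (chiword chi (w_ i) (g_ j')); first exact: chiword_neq0.
    by rewrite superletter_semi_inv // subrr; exact: lspan0.
  - by have := ltn_ord i'; lia.
  - exists 1; first exact: oner_neq0.
    have /(congr1 val)/= -> := abG (g_ j) (g_ j').
    by rewrite scale1r subrr; exact: lspan0.
  have lt_w := w_lt _ _ lt_rank.
  exists (pword g chi (w_ i) (w_ i')); first exact: chiword_neq0.
  have := skew_reduced g chi_char semi_inv d_gt0 (w_std i) (w_std i') lt_w.
  apply: lspan_sub => y /reduced_word[l [l' [dl' ->]]].
  apply: lspan_gen; exists (map inr l ++ map inl l') => //.
  have deg_l : mdeg deg (map inr l ++ map inl l') = (\sum_(i <- l') wdeg d (w_ i))%N.
    by rewrite mdeg_cat /mdeg !big_map /= big1_eq.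
  rewrite /mlt deg_l [mdeg deg [:: _; _]]/mdeg !big_cons big_nil addn0 /=.
  case: dl' => [|[-> wl']]; [by left | right; split=> //].
  (* In top degree every super-letter is at most the word [w_ i ++ w_ i'], which is below its proper
     prefix [w_ i]. So [inl i] and all letters before it are absent, and the count of [inl i] falls
     from 1 to 0. *)
  have w_notin (m : 'I_(size s)) : (m <= i)%N ->
      count_mem (inl m : T) (map inr l ++ map inl l') = 0%N.
    move=> le_mi; apply/count_memPn; rewrite mem_cat; apply/negP.
    case/orP=> /mapP[m' m'l] // [eq_m]; move: m'l; rewrite -eq_m => /wl' le_m.
    have lt_m : wlt (w_ i ++ w_ i') (w_ m).
      have lt_cat : wlt (w_ i ++ w_ i') (w_ i).
        rewrite -[X in wlt _ X]cats0 wlt_cat2l /wlt.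
        by case: (w_ i') (w_std i') => // -[].
      move: le_mi; rewrite leq_eqVlt => /orP[/eqP/val_inj -> //|/w_lt].
      exact: wlt_trans.
    by have := wle_lt_trans le_m lt_m; rewrite wlt_irr.
  exists (inl i); first by rewrite w_notin //= eqxx.
  move=> [m|m] /= lt_m; last by have := ltn_ord i; lia.
  rewrite w_notin 1?ltnW //=.
  have neq (m' : 'I_(size s)) : (m < m')%N -> (inl m' == inl m :> T) = false.
    by move=> lt_m'; apply/eqP => -[eq_m]; rewrite eq_m ltnn in lt_m'.
  by rewrite !neq // (ltn_trans lt_m).
split.
  exact: quasi_commutative_left_noetherian rank_inj commutation span.
exact: quasi_commutative_right_noetherian rank_inj commutation span.
Qed.
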